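(* Let $D$ be a domain in $\mathbb{C}^n$, let $k\ge 0$ be an integer, and let $c>0$ and $\alpha>1$ be constants. Then the family $$\mathcal{F}=\left\{f\in\mathcal{H}(D):\ \sup_{\|v\|=1}\frac{|(D^kf(z),v)|}{1+|f(z)|^{\alpha}}>c\ \text{ for all } z\in D\right\}$$ is normal in $D$.
   Context: $\mathcal{H}(D)$ is the set of holomorphic functions $D\to\mathbb{C}$. $D^k$ denotes the operator $\left(\frac{\partial^k}{\partial z_1^k},\dots,\frac{\partial^k}{\partial z_n^k}\right)$ (for $k=0$, each component is the identity), and $(D^kf(z),v)=\sum_{j=1}^n \frac{\partial^k f}{\partial z_j^k}(z)\,v_j$ for $v=(v_1,\dots,v_n)\in\mathbb{C}^n$; the supremum is over $v\in\mathbb{C}^n$ with Euclidean norm $1$. A family is normal in $D$ if every sequence in it has a subsequence converging locally uniformly in $D$. *)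

(* Defs.v *)
From HB Require Import structures.
From mathcomp Require Import all_boot all_order all_algebra.
From mathcomp Require Import complex.
From mathcomp Require Import all_classical all_reals all_analysis.
Import Order.TTheory GRing.Theory Num.Theory.
Import numFieldNormedType.Exports.
Set Implicit Arguments. Unset Strict Implicit. Unset Printing Implicit Defensive.
Local Open Scope ring_scope.
Local Open Scope classical_set_scope.

Notation Cx R := ((R[i])^o).

Definition cabs (R : realType) (z : R[i]) : R :=
  Num.sqrt (complex.Re z ^+ 2 + complex.Im z ^+ 2).

Definition domain (R : realType) (n : nat) (D : set 'rV[Cx R]_n) : Prop :=
  D !=set0 /\ open D /\ connected D.

(* holomorphic on D: complex (Frechet) differentiable at every point of D
   (the differential is C-linear since 'rV[C]_n is a normed C-module) *)
Definition holomorphic_on (R : realType) (n : nat) (D : set 'rV[Cx R]_n)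
  (f : 'rV[Cx R]_n -> Cx R) : Prop :=
  forall z, D z -> differentiable f z.

Definition evec (R : realType) (n : nat) (j : 'I_n) : 'rV[Cx R]_n := delta_mx 0 j.

Definition pdz (R : realType) (n : nat) (j : 'I_n) (f : 'rV[Cx R]_n -> Cx R)
  : 'rV[Cx R]_n -> Cx R := fun z => 'D_(evec R j) f z.

Definition pdzk (R : realType) (n : nat) (k : nat) (j : 'I_n)
  (f : 'rV[Cx R]_n -> Cx R) : 'rV[Cx R]_n -> Cx R := iter k (@pdz R n j) f.

Definition Dk_pair (R : realType) (n : nat) (k : nat) (f : 'rV[Cx R]_n -> Cx R)
  (z v : 'rV[Cx R]_n) : Cx R :=
  \sum_(j < n) pdzk k j f z * v 0 j.

Definition unit_vec (R : realType) (n : nat) (v : 'rV[Cx R]_n) : Prop :=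
  \sum_(j < n) cabs (v 0 j) ^+ 2 = 1.

Definition normal_family (R : realType) (n : nat) (D : set 'rV[Cx R]_n)
  (F : set ('rV[Cx R]_n -> Cx R)) : Prop :=
  forall u : nat -> ('rV[Cx R]_n -> Cx R), (forall m, F (u m)) ->
  exists phi : nat -> nat, {homo phi : a b / (a < b)%N} /\
  exists g : 'rV[Cx R]_n -> Cx R,
    forall z, D z -> exists U, nbhs z U /\
      forall eps : R, 0 < eps -> exists N : nat, forall m, (N <= m)%N ->
        forall w, U w -> D w -> cabs (u (phi m) w - g w) < eps.

(* Main.v *)
Require Import Defs.
From HB Require Import structures.
From mathcomp Require Import all_boot all_order all_algebra.
From mathcomp Require Import complex.
From mathcomp Require Import all_classical all_reals all_analysis.
From mathcomp Require Import ring lra.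
Import Order.TTheory GRing.Theory Num.Theory.
Import numFieldNormedType.Exports.
Set Implicit Arguments. Unset Strict Implicit. Unset Printing Implicit Defensive.
Local Open Scope ring_scope.
Local Open Scope classical_set_scope.

(** Let f be in the family and maximise (r - |z - p|)^(k+1) |f(z)|^(alpha-1)
    over a closed polydisc of radius r about p. At a near-maximum q, with
    d = r - |q - p|, the function |f| is at most a constant times |f(q)| on
    the polydisc of radius d/2 about q, so Cauchy's estimates give
    |D^k f(q)| <= C |f(q)| / d^k. Together with
    c |f(q)|^alpha < |D^k f(q)| this bounds d^k |f(q)|^(alpha-1), hence
    the maximum, by a constant independent of f. The family is therefore
    locally uniformly bounded, and Montel's theorem applies.

    Cauchy's estimates, for functions that are only assumed to be complex
    differentiable, come from Goursat's lemma on rectangles: for w inside a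
    square S, f(w) N(w) = G(w), where G(w) and N(w) are the integrals of
    f(z)/(z-w) and 1/(z-w) along the boundary of S. The value 2 pi i of N is not
    needed, only |N| >= 1/2 and the differentiability of N and G. *)

(** * Complex modulus and derivatives *)

Section ComplexModulus.
Local Open Scope complex_scope.
Context {R : realType}.
Implicit Types z w : R[i].

(** The weight has exponent k+1 although Cauchy's estimates only control d^k. With exponent k it
    would be constantly 1 when k = 0; exponent k+1 makes it vanish on the boundary of the polydisc,
    which forces d > 0 at a near-maximum. The surplus factor d is at most r.

    The assumption alpha > 1 enters through the positive exponent alpha - 1: both inequalities for
    D^k f(q) contain a factor |f(q)|, and once it is cancelled a positive power of |f(q)| remains to
    be bounded.

    D^k involves only pure derivatives in coordinate directions, so everything reduces to one
    variable on complex lines. Iterating the estimate k times requires f' to be complex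
    differentiable again, and this has to be proved from mere differentiability of f: it follows by
    solving (f N)' = G' for f', because G' and N' are integrals that can be differentiated once
    more. *)

Lemma cabsE z : cabs z = ComplexField.Normc.normc z. Proof. by case: z. Qed.

Lemma cabs_ge0 z : 0 <= cabs z. Proof. exact: sqrtr_ge0. Qed.

Lemma cabsM z w : cabs (z * w) = cabs z * cabs w.
Proof. by rewrite !cabsE ComplexField.Normc.normcM. Qed.

Lemma cabsV z : cabs z^-1 = (cabs z)^-1.
Proof. by rewrite !cabsE ComplexField.Normc.normcV. Qed.

Lemma cabsN z : cabs (- z) = cabs z.
Proof. by rewrite /cabs; case: z => a b /=; rewrite !sqrrN. Qed.

Lemma cabsB z w : cabs (z - w) = cabs (w - z).
Proof. by rewrite -cabsN opprB. Qed.

Lemma cabs0 : cabs (0 : R[i]) = 0. Proof. by rewrite cabsE ComplexField.Normc.normc0. Qed.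

Lemma cabs1 : cabs (1 : R[i]) = 1. Proof. by rewrite cabsE ComplexField.Normc.normc1. Qed.

Lemma normr_cabs z : `|z| = (cabs z)%:C. Proof. by rewrite normc_def. Qed.

Lemma ler_cabsD z w : cabs (z + w) <= cabs z + cabs w.
Proof. by rewrite -lecR rmorphD /= -!normr_cabs ler_normD. Qed.

Lemma ler_cabsB z w : cabs (z - w) <= cabs z + cabs w.
Proof. by rewrite -(cabsN w) ler_cabsD. Qed.

Lemma ler_cabs_dist u z w : cabs (z - w) <= cabs (z - u) + cabs (u - w).
Proof. by rewrite (le_trans _ (ler_cabsD _ _))// addrA subrK. Qed.

Lemma cabs_eq0 z : (cabs z == 0) = (z == 0).
Proof.
apply/eqP/eqP => [|->]; last exact: cabs0.
by rewrite cabsE => /ComplexField.Normc.eq0_normc.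
Qed.

Lemma cabs_gt0 z : (0 < cabs z) = (z != 0).
Proof. by rewrite lt0r cabs_ge0 andbT cabs_eq0. Qed.

Lemma normr_Re_cabs z : `|complex.Re z| <= cabs z.
Proof. by rewrite -sqrtr_sqr ler_wsqrtr// lerDl sqr_ge0. Qed.

Lemma normr_Im_cabs z : `|complex.Im z| <= cabs z.
Proof. by rewrite -sqrtr_sqr ler_wsqrtr// lerDr sqr_ge0. Qed.

Lemma cabs_real (x : R) : cabs x%:C = `|x|.
Proof. by rewrite /cabs /= expr0n addr0 sqrtr_sqr. Qed.

Lemma cabs_i : cabs ('i : R[i]) = 1.
Proof. by rewrite /cabs /= expr0n expr1n add0r sqrtr1. Qed.

Lemma cabs_le_ReIm z : cabs z <= `|complex.Re z| + `|complex.Im z|.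
Proof.
rewrite {1}(complexE z) (le_trans (ler_cabsD _ _))//.
by rewrite cabsM cabs_i mul1r !cabs_real.
Qed.

Lemma cabsX z n : cabs (z ^+ n) = cabs z ^+ n.
Proof. by elim: n => [|n ih]; rewrite ?expr0 ?cabs1// !exprS cabsM ih. Qed.

End ComplexModulus.

Section LocalNotions.
Local Open Scope complex_scope.
Context {R : realType}.
Implicit Types (f g : R[i] -> R[i]) (z w : R[i]).

Definition ccts f z := forall e : R, 0 < e -> exists2 d : R, 0 < d &
  forall w, cabs (w - z) < d -> cabs (f w - f z) < e.

(** The remainder is compared with e * |w - z| without dividing, so w = z is harmless. Measuring
    with the real-valued [cabs] keeps all estimates in R, where [lra] applies. *)
Definition cdiff f z l := forall e : R, 0 < e -> exists2 d : R, 0 < d &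
  forall w, cabs (w - z) < d -> cabs (f w - f z - l * (w - z)) <= e * cabs (w - z).

Lemma cdiff_ccts f z l : cdiff f z l -> ccts f z.
Proof.
move=> fz e e0; have [d d0 H] := fz 1 ltr01.
have k0 : 0 < 1 + cabs l by rewrite ltr_pwDl// cabs_ge0.
exists (Num.min d (e / (1 + cabs l))); first by rewrite lt_min d0 divr_gt0.
move=> w; rewrite lt_min => /andP[/H wd].
rewrite ltr_pdivlMr// => we.
have -> : f w - f z = (f w - f z - l * (w - z)) + l * (w - z) by ring.
apply: le_lt_trans (ler_cabsD _ _) _; rewrite cabsM.
by apply: le_lt_trans we; lra.
Qed.

Lemma ccts_cst c z : ccts (fun=> c) z.
Proof. by move=> e e0; exists 1 => // w _; rewrite subrr cabs0. Qed.

Lemma ccts_id z : ccts id z.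
Proof. by move=> e e0; exists e. Qed.

Lemma ccts_add f g z : ccts f z -> ccts g z -> ccts (fun w => f w + g w) z.
Proof.
move=> fz gz e e0; have e20 : 0 < e / 2 by rewrite divr_gt0.
have [d d0 H] := fz _ e20; have [d' d'0 H'] := gz _ e20.
exists (Num.min d d'); first by rewrite lt_min d0.
move=> w; rewrite lt_min => /andP[/H h /H' h'].
have -> : f w + g w - (f z + g z) = (f w - f z) + (g w - g z) by ring.
by apply: le_lt_trans (ler_cabsD _ _) _; lra.
Qed.

Lemma ccts_mul f g z : ccts f z -> ccts g z -> ccts (fun w => f w * g w) z.
Proof.
move=> fz gz e e0.
pose M := 1 + cabs (f z) + cabs (g z).
have M0 : 0 < M by rewrite /M; have := cabs_ge0 (f z); have := cabs_ge0 (g z); lra.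
(* As h <= 1, the product of the two increments is at most h, so the three terms below add up to at
   most h * M <= e / 2. *)
pose h := Num.min 1 (e / (2 * M)).
have h0 : 0 < h by rewrite lt_min ltr01 divr_gt0// mulr_gt0.
have h1 : h <= 1 by rewrite ge_min lexx.
have hM : h * (2 * M) <= e.
  by rewrite -ler_pdivlMr ?mulr_gt0// ge_min lexx orbT.
have [d d0 H] := fz _ h0; have [d' d'0 H'] := gz _ h0.
exists (Num.min d d'); first by rewrite lt_min d0.
move=> w; rewrite lt_min => /andP[/H hf /H' hg].
have -> : f w * g w - f z * g z =
  (f w - f z) * (g w - g z) + (f w - f z) * g z + f z * (g w - g z) by ring.
apply: le_lt_trans (ler_cabsD _ _) _.
apply: le_lt_trans (lerD (ler_cabsD _ _) (lexx _)) _; rewrite !cabsM.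
have := cabs_ge0 (f z); have := cabs_ge0 (g z).
have := cabs_ge0 (f w - f z); have := cabs_ge0 (g w - g z).
rewrite /M in hM.
move: (cabs (f w - f z)) (cabs (g w - g z)) hf hg => x y xh yh y0 x0 b0 a0.
have : x * y <= h by have := ler_pM x0 y0 (ltW xh) (ltW yh); nra.
have : x * cabs (g z) <= h * cabs (g z) by rewrite ler_wpM2r// ltW.
have : cabs (f z) * y <= cabs (f z) * h by rewrite ler_wpM2l// ltW.
nra.
Qed.

Lemma ccts_inv f z : ccts f z -> f z != 0 -> ccts (fun w => (f w)^-1) z.
Proof.
move=> fz fz0 e e0.
have m0 : 0 < cabs (f z) by rewrite cabs_gt0.
pose m := cabs (f z).
(* The first bound forces |f w| > m / 2; the second is then below e * |f w| * |f z|. *)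
have h0 : 0 < Num.min (m / 2) (e * m ^+ 2 / 2).
  by rewrite lt_min !divr_gt0// mulr_gt0// exprn_gt0.
have [d d0 H] := fz _ h0; exists d => // w /H; rewrite lt_min => /andP[h1 h2].
have fw : m / 2 < cabs (f w).
  have := ler_cabsD (f w) (f z - f w).
  by rewrite (addrC (f w)) subrK (cabsB (f z)) -/m; lra.
have fw0 : f w != 0 by rewrite -cabs_gt0 (lt_trans _ fw)// divr_gt0.
have -> : (f w)^-1 - (f z)^-1 = (f z - f w) / (f w * f z).
  by field; rewrite fw0 fz0.
rewrite cabsM cabsV cabsM ltr_pdivrMr; last by rewrite mulr_gt0// cabs_gt0.
rewrite cabsB (lt_le_trans h2)// -/m expr2.
have : m / 2 * m <= cabs (f w) * m by rewrite ler_wpM2r ?cabs_ge0// ltW.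
nra.
Qed.

Lemma ccts_near f g z : ccts f z ->
  (exists2 d : R, 0 < d & forall w, cabs (w - z) < d -> f w = g w) -> ccts g z.
Proof.
move=> fz [d d0 fg] e e0; have [d' d'0 H] := fz e e0.
exists (Num.min d d'); first by rewrite lt_min d0.
move=> w; rewrite lt_min => /andP[h1 h2].
by rewrite -fg// -fg ?subrr ?cabs0//; exact: H.
Qed.

Lemma cdiff_near f g z l : cdiff f z l ->
  (exists2 d : R, 0 < d & forall w, cabs (w - z) < d -> f w = g w) -> cdiff g z l.
Proof.
move=> fz [d d0 fg] e e0; have [d' d'0 H] := fz e e0.
exists (Num.min d d'); first by rewrite lt_min d0.
move=> w; rewrite lt_min => /andP[h1 h2].
by rewrite -fg// -fg ?subrr ?cabs0//; exact: H.
Qed.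

Lemma cdiff_cst c z : cdiff (fun=> c) z 0.
Proof.
move=> e e0; exists 1 => // w _.
by rewrite mul0r subr0 subrr cabs0; apply: mulr_ge0; [exact: ltW|exact: cabs_ge0].
Qed.

Lemma cdiff_id z : cdiff id z 1.
Proof.
move=> e e0; exists 1 => // w _.
by rewrite mul1r subrr cabs0; apply: mulr_ge0; [exact: ltW|exact: cabs_ge0].
Qed.

Lemma cdiff_add f g z l m : cdiff f z l -> cdiff g z m ->
  cdiff (fun w => f w + g w) z (l + m).
Proof.
move=> fz gz e e0; have e20 : 0 < e / 2 by rewrite divr_gt0.
have [d d0 H] := fz _ e20; have [d' d'0 H'] := gz _ e20.
exists (Num.min d d'); first by rewrite lt_min d0.
move=> w; rewrite lt_min => /andP[/H h /H' h'].
have -> : f w + g w - (f z + g z) - (l + m) * (w - z) =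
  (f w - f z - l * (w - z)) + (g w - g z - m * (w - z)) by ring.
by apply: le_trans (ler_cabsD _ _) _; lra.
Qed.

Lemma cdiff_uniq f z l m : cdiff f z l -> cdiff f z m -> l = m.
Proof.
move=> fl fm; apply/eqP; rewrite -subr_eq0 -cabs_eq0 eq_le cabs_ge0 andbT.
rewrite leNgt; apply/negP => k0.
(* Two errors of one third each cannot add up to |l - m|; they are compared at a real increment t
   inside both radii. *)
have e0 : 0 < cabs (l - m) / 3 by rewrite divr_gt0.
have [d d0 H] := fl _ e0; have [d' d'0 H'] := fm _ e0.
pose t := Num.min d d' / 2.
have t0 : 0 < t by rewrite divr_gt0// lt_min d0.
have td : t < d.
  have : Num.min d d' <= d by rewrite ge_min lexx.
  by rewrite /t; lra.
have td' : t < d'.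
  have : Num.min d d' <= d' by rewrite ge_min lexx orbT.
  by rewrite /t; lra.
have tz : z + t%:C - z = t%:C by rewrite addrC addKr.
have := H (z + t%:C); have := H' (z + t%:C).
rewrite !tz cabs_real gtr0_norm// => /(_ td') h' /(_ td) h.
have := ler_cabsB (f (z + t%:C) - f z - m * t%:C) (f (z + t%:C) - f z - l * t%:C).
have -> : f (z + t%:C) - f z - m * t%:C - (f (z + t%:C) - f z - l * t%:C)
  = (l - m) * t%:C by ring.
rewrite cabsM cabs_real gtr0_norm//; nra.
Qed.

(* Caratheodory's criterion: the slope is continuous; it makes the product and
   inverse rules purely algebraic. *)
Lemma cdiff_slope f z l (q : R[i] -> R[i]) : ccts q z -> q z = l ->
  (exists2 d : R, 0 < d & forall w, cabs (w - z) < d -> f w - f z = q w * (w - z)) ->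
  cdiff f z l.
Proof.
move=> qz ql [d d0 fq] e e0; have [d' d'0 H] := qz _ e0.
exists (Num.min d d'); first by rewrite lt_min d0.
move=> w; rewrite lt_min => /andP[h1 h2].
rewrite fq// -mulrBl cabsM ler_wpM2r ?cabs_ge0// -ql ltW//; exact: H.
Qed.

Lemma slope_cdiff f z l : cdiff f z l -> exists q : R[i] -> R[i],
  [/\ ccts q z, q z = l & forall w, f w - f z = q w * (w - z)].
Proof.
move=> fz; pose q w := if w == z then l else (f w - f z) / (w - z).
have qz : q z = l by rewrite /q eqxx.
exists q; split=> //.
  move=> e e0; have e20 : 0 < e / 2 by rewrite divr_gt0.
  have [d d0 H] := fz _ e20; exists d => // w wd.
  rewrite qz /q; case: eqVneq => [_|wz]; first by rewrite subrr cabs0.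
  have wz0 : w - z != 0 by rewrite subr_eq0.
  have -> : (f w - f z) / (w - z) - l = (f w - f z - l * (w - z)) / (w - z).
    by field.
  rewrite cabsM cabsV ltr_pdivrMr ?cabs_gt0//.
  apply: le_lt_trans (H _ wd) _.
  by rewrite ltr_pM2r ?cabs_gt0// ltr_pdivrMr// ltr_pMr// ltr1n.
move=> w; rewrite /q; case: eqVneq => [->|wz]; first by rewrite !subrr mulr0.
by rewrite divfK// subr_eq0.
Qed.

Lemma cdiff_mul f g z l m : cdiff f z l -> cdiff g z m ->
  cdiff (fun w => f w * g w) z (l * g z + f z * m).
Proof.
move=> fz gz; have /slope_cdiff[p [pz pl pE]] := fz.
have /slope_cdiff[q [qz qm qE]] := gz.
apply: (@cdiff_slope _ _ _ (fun w => p w * g w + f z * q w)).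
- apply: ccts_add; apply: ccts_mul => //; first exact: cdiff_ccts gz.
  exact: ccts_cst.
- by rewrite pl qm.
- exists 1 => // w _; rewrite mulrDl -mulrA (mulrC (g w)) mulrA -pE.
  by rewrite -mulrA -qE; ring.
Qed.

Lemma cdiff_inv f z l : cdiff f z l -> f z != 0 ->
  cdiff (fun w => (f w)^-1) z (- l / f z ^+ 2).
Proof.
move=> fz fz0; have /slope_cdiff[p [pz pl pE]] := fz.
have fc := cdiff_ccts fz.
have [d d0 H] : exists2 d : R, 0 < d & forall w, cabs (w - z) < d -> f w != 0.
  have cfz : 0 < cabs (f z) by rewrite cabs_gt0.
  have [d d0 H] := fc _ cfz; exists d => // w /H; apply: contraTneq => ->.
  by rewrite sub0r cabsN ltxx.
apply: (@cdiff_slope _ _ _ (fun w => (- p w) * ((f w)^-1 * (f z)^-1))).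
- apply: ccts_mul; last by apply: ccts_mul; [exact: ccts_inv|exact: ccts_cst].
  apply: (@ccts_near (fun w => (-1) * p w)); last by exists 1 => // w _; ring.
  by apply: ccts_mul => //; exact: ccts_cst.
- by rewrite pl expr2 invfM.
- exists d => // w /H fw0; rewrite mulrAC mulNr -pE.
  by field; rewrite fw0 fz0.
Qed.

(** This is how the Lipschitz estimate [disc_lipschitz] becomes a bound on the derivative. *)
Lemma cdiff_lip f z l K (d : R) : cdiff f z l -> 0 < d ->
  (forall w, cabs (w - z) < d -> cabs (f w - f z) <= K * cabs (w - z)) -> cabs l <= K.
Proof.
move=> fz d0 HK; apply/ler_addgt0Pr => e e0.
have [d' d'0 H] := fz _ e0.
pose t := Num.min d d' / 2.
have t0 : 0 < t by rewrite divr_gt0// lt_min d0.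
have td : t < d.
  have : Num.min d d' <= d by rewrite ge_min lexx.
  by rewrite /t; lra.
have td' : t < d'.
  have : Num.min d d' <= d' by rewrite ge_min lexx orbT.
  by rewrite /t; lra.
have tz : z + t%:C - z = t%:C by rewrite addrC addKr.
have := HK (z + t%:C); have := H (z + t%:C).
rewrite !tz cabs_real gtr0_norm// => /(_ td') h' /(_ td) h.
have := ler_cabsB (f (z + t%:C) - f z) (f (z + t%:C) - f z - l * t%:C).
have -> : f (z + t%:C) - f z - (f (z + t%:C) - f z - l * t%:C) = l * t%:C by ring.
rewrite cabsM cabs_real gtr0_norm// => h2.
by rewrite -(ler_pM2r t0); lra.
Qed.

End LocalNotions.

(** * Integrals over intervals *)

Section IntervalIntegral.
Local Open Scope complex_scope.
Context {R : realType}.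
Notation mu := (@lebesgue_measure R).
Implicit Types (g h : R -> R[i]) (a b t : R).

Definition cts_at g t := forall e : R, 0 < e -> exists2 d : R, 0 < d &
  forall s, `|s - t| < d -> cabs (g s - g t) < e.

(** Continuity is two-sided even at the endpoints: the integrands are restrictions of functions that
    are continuous in the plane at every point of the contour. *)
Definition cts_on a b g := forall t, a <= t <= b -> cts_at g t.

Definition rint a b (u : R -> R) : R := \int[mu]_(t in `[a, b]) u t.

Definition cint a b g : R[i] :=
  rint a b (fun t => complex.Re (g t)) +i* rint a b (fun t => complex.Im (g t)).

Definition rcts_on a b (u : R -> R) := forall t, a <= t <= b ->
  forall e : R, 0 < e -> exists2 d : R, 0 < d &
  forall s, `|s - t| < d -> `|u s - u t| < e.

Lemma rcts_within a b u : rcts_on a b u -> {within `[a, b], continuous u}.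
Proof.
move=> uc; apply: continuous_in_subspaceT => t.
rewrite inE /= in_itv /= => /uc tc; apply/cvgrPdist_lt => e /tc[d d0 H].
near=> s; rewrite distrC; apply: H; near: s.
apply/nbhs_ballP; exists d => //= s.
by rewrite /ball /= distrC.
Unshelve. all: by end_near. Qed.

Lemma rcts_integrable a b u : rcts_on a b u -> mu.-integrable `[a, b] (EFin \o u).
Proof.
move=> uc; apply: continuous_compact_integrable; first exact: segment_compact.
exact: rcts_within.
Qed.

Lemma cts_Re a b g : cts_on a b g -> rcts_on a b (fun t => complex.Re (g t)).
Proof.
move=> gc t /gc tc e /tc[d d0 H]; exists d => // s /H; apply: le_lt_trans.
by rewrite -raddfB normr_Re_cabs.
Qed.

Lemma cts_Im a b g : cts_on a b g -> rcts_on a b (fun t => complex.Im (g t)).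
Proof.
move=> gc t /gc tc e /tc[d d0 H]; exists d => // s /H; apply: le_lt_trans.
by rewrite -raddfB normr_Im_cabs.
Qed.

Lemma rintD a b u v : rcts_on a b u -> rcts_on a b v ->
  rint a b (fun t => u t + v t) = rint a b u + rint a b v.
Proof. by move=> uc vc; apply: RintegralD => //; exact: rcts_integrable. Qed.

Lemma rintB a b u v : rcts_on a b u -> rcts_on a b v ->
  rint a b (fun t => u t - v t) = rint a b u - rint a b v.
Proof. by move=> uc vc; apply: RintegralB => //; exact: rcts_integrable. Qed.

Lemma rintZ a b k u : rcts_on a b u ->
  rint a b (fun t => k * u t) = k * rint a b u.
Proof. by move=> uc; apply: RintegralZl => //; exact: rcts_integrable. Qed.

Lemma rcts_cst a b (k : R) : rcts_on a b (fun=> k).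
Proof. by move=> t _ e e0; exists 1 => // s _; rewrite subrr normr0. Qed.

Lemma rcts_scale a b k u : rcts_on a b u -> rcts_on a b (fun t => k * u t).
Proof.
move=> uc t /uc tc e e0; have k0 : 0 < 1 + `|k| by rewrite ltr_pwDl.
have [|d d0 H] := tc (e / (1 + `|k|)); first by rewrite divr_gt0.
exists d => // s /H; rewrite ltr_pdivlMr// => ue.
rewrite -mulrBr normrM (le_lt_trans _ ue)//.
by rewrite mulrC ler_wpM2l// lerDr.
Qed.

Lemma rint_cst a b k : a <= b -> rint a b (fun=> k) = k * (b - a).
Proof.
move=> ab; rewrite /rint Rintegral_cst//= lebesgue_measure_itv /= lte_fin.
by move: ab; rewrite le_eqVlt => /predU1P[->|->]; rewrite ?ltxx ?subrr.
Qed.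

Lemma rint_le a b u v : rcts_on a b u -> rcts_on a b v ->
  (forall t, a <= t <= b -> u t <= v t) -> rint a b u <= rint a b v.
Proof.
by move=> uc vc uv; apply: le_Rintegral => //; exact: rcts_integrable.
Qed.

Lemma rint_bound a b u M : a <= b -> rcts_on a b u ->
  (forall t, a <= t <= b -> `|u t| <= M) -> `|rint a b u| <= M * (b - a).
Proof.
move=> ab uc uM; rewrite ler_norml; apply/andP; split.
  rewrite -mulNr -rint_cst//; apply: rint_le => // [|t /uM].
    exact: rcts_cst.
  by rewrite ler_norml => /andP[].
rewrite -rint_cst//; apply: rint_le => // [|t /uM]; first exact: rcts_cst.
by rewrite ler_norml => /andP[].
Qed.

Lemma rint_chasles a b c u : a <= b -> b <= c -> rcts_on a c u ->
  rint a c u = rint a b u + rint b c u.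
Proof.
move=> ab bc uc; have iu := rcts_integrable uc.
have := @Rintegral_itvB R u (BLeft a) (BRight c) b iu.
rewrite !bnd_simp => /(_ ab bc) /eqP.
rewrite /rint subr_eq => /eqP ->; rewrite addrC; congr (_ + _).
rewrite Rintegral_itv_obnd_cbnd//; apply: integrableS iu => //.
by apply: subset_itv; rewrite bnd_simp.
Qed.

Lemma rint_id a b : a <= b -> rint a b id = (b ^+ 2 - a ^+ 2) / 2.
Proof.
rewrite le_eqVlt => /predU1P[->|ab].
  by rewrite subrr mul0r /rint set_itv1 Rintegral_set1.
pose F (t : R) := t ^+ 2 / 2.
have dF t : is_derive t 1 F t.
  rewrite /F; apply: is_derive_eq.
  by rewrite !scaler0 add0r /GRing.scale /=; field.
have cF : continuous F.
  move=> t; apply: differentiable_continuous; apply/derivable1_diffP.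
  by have [] := dF t.
have cid_ : {within `[a, b], continuous (id : R -> R)}.
  by apply: continuous_subspaceT => t.
have := @continuous_FTC2 R id F a b ab cid_.
rewrite /rint /Rintegral => -> //=.
- by rewrite /F; field.
- split=> [t _||]; first by have [] := dF t.
    by apply: cvg_at_right_filter; exact: cF.
  by apply: cvg_at_left_filter; exact: cF.
- by move=> t _; rewrite derive1E; have [_ ->] := dF t.
Qed.

End IntervalIntegral.

Section ComplexIntegral.
Local Open Scope complex_scope.
Context {R : realType}.
Implicit Types (g h : R -> R[i]) (a b t : R).

Lemma cts_onZ a b (k : R[i]) g : cts_on a b g -> cts_on a b (fun t => k * g t).
Proof.
move=> gc t /gc tc e e0; have k0 : 0 < 1 + cabs k by rewrite ltr_pwDl// cabs_ge0.
have [|d d0 H] := tc (e / (1 + cabs k)); first by rewrite divr_gt0.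
exists d => // s /H; rewrite ltr_pdivlMr// => ue.
rewrite -mulrBr cabsM (le_lt_trans _ ue)//.
by rewrite mulrC ler_wpM2l ?cabs_ge0// lerDr.
Qed.

Lemma eq_cint a b g h : (forall t, a <= t <= b -> g t = h t) ->
  cint a b g = cint a b h.
Proof.
move=> gh; rewrite /cint /rint; congr (_ +i* _); apply: eq_Rintegral => t;
  by rewrite inE /= in_itv /= => /gh ->.
Qed.

Lemma cintD a b g h : cts_on a b g -> cts_on a b h ->
  cint a b (fun t => g t + h t) = cint a b g + cint a b h.
Proof.
move=> gc hc; rewrite /cint.
rewrite -[RHS]/(_ +i* _) -!rintD; try exact: cts_Re; try exact: cts_Im.
by congr (rint _ _ _ +i* rint _ _ _); apply/funext => t; rewrite raddfD.
Qed.

Lemma cintZ a b (k : R[i]) g : cts_on a b g ->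
  cint a b (fun t => k * g t) = k * cint a b g.
Proof.
move=> gc; have rc := cts_Re gc; have ic := cts_Im gc.
rewrite /cint; case: k => p q; rewrite -[RHS]/(_ +i* _) -!rintZ//.
rewrite -rintB -?rintD; try exact: rcts_scale.
by congr (rint _ _ _ +i* rint _ _ _); apply/funext => t; case: (g t).
Qed.

Lemma cint_cst a b (k : R[i]) : a <= b -> cint a b (fun=> k) = k * (b - a)%:C.
Proof.
by move=> ab; rewrite /cint !rint_cst//; case: k => p q; simpc.
Qed.

Lemma cint_id a b : a <= b ->
  cint a b (fun t => t%:C) = ((b ^+ 2 - a ^+ 2) / 2)%:C.
Proof.
move=> ab; rewrite /cint /= -(rint_id ab).
by rewrite rint_cst// mul0r.
Qed.

Lemma cint_chasles a b c g : a <= b -> b <= c -> cts_on a c g ->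
  cint a c g = cint a b g + cint b c g.
Proof.
move=> ab bc gc; rewrite /cint (rint_chasles ab bc (cts_Re gc)).
by rewrite (rint_chasles ab bc (cts_Im gc)).
Qed.

(** The factor 2 comes from bounding real and imaginary parts separately; later constants only have
    to be independent of the function. *)
Lemma cint_bound a b g M : a <= b -> cts_on a b g ->
  (forall t, a <= t <= b -> cabs (g t) <= M) ->
  cabs (cint a b g) <= 2 * M * (b - a).
Proof.
move=> ab gc gM; apply: le_trans (cabs_le_ReIm _) _ => /=.
have hr : `|rint a b (fun t => complex.Re (g t))| <= M * (b - a).
  apply: rint_bound ab (cts_Re gc) _ => t /gM.
  exact/le_trans/normr_Re_cabs.
have hi : `|rint a b (fun t => complex.Im (g t))| <= M * (b - a).
  apply: rint_bound ab (cts_Im gc) _ => t /gM.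
  exact/le_trans/normr_Im_cabs.
by rewrite -mulrA mulr_natl mulr2n lerD.
Qed.

Lemma cint_Im_ge a b g m : a <= b -> cts_on a b g ->
  (forall t, a <= t <= b -> m <= complex.Im (g t)) ->
  m * (b - a) <= complex.Im (cint a b g).
Proof.
move=> ab gc gm; rewrite /cint /= -rint_cst//.
by apply: rint_le => //; [exact: rcts_cst|exact: cts_Im].
Qed.

End ComplexIntegral.

(** * Integrals along rectangles *)

Section RectangleIntegral.
Local Open Scope complex_scope.
Context {R : realType}.
Implicit Types (f g : R[i] -> R[i]) (x y : R) (z w : R[i]).

Definition in_rect x1 x2 y1 y2 z :=
  (x1 <= complex.Re z <= x2) && (y1 <= complex.Im z <= y2).

Definition on_bd x1 x2 y1 y2 z := in_rect x1 x2 y1 y2 z &&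
  [|| complex.Re z == x1, complex.Re z == x2, complex.Im z == y1 | complex.Im z == y2].

Definition hint f y x1 x2 := cint x1 x2 (fun t => f (t +i* y)).
Definition vint f x y1 y2 := cint y1 y2 (fun t => f (x +i* t)).

(** The counterclockwise contour integral: dz is dt on horizontal sides and i dt on vertical
    ones. *)
Definition rectint f x1 x2 y1 y2 : R[i] :=
  hint f y1 x1 x2 - hint f y2 x1 x2 + 'i * (vint f x2 y1 y2 - vint f x1 y1 y2).

Definition bd_cts f x1 x2 y1 y2 := forall z, on_bd x1 x2 y1 y2 z -> ccts f z.

Lemma h_cts f y x1 x2 : (forall t, x1 <= t <= x2 -> ccts f (t +i* y)) ->
  cts_on x1 x2 (fun t => f (t +i* y)).
Proof.
move=> fc t /fc tc e /tc[d d0 H]; exists d => // s sd; apply: H.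
suff -> : s +i* y - (t +i* y) = (s - t)%:C by rewrite cabs_real.
by apply/eqP; rewrite eq_complex /= subrr !eqxx.
Qed.

Lemma v_cts f x y1 y2 : (forall t, y1 <= t <= y2 -> ccts f (x +i* t)) ->
  cts_on y1 y2 (fun t => f (x +i* t)).
Proof.
move=> fc t /fc tc e /tc[d d0 H]; exists d => // s sd; apply: H.
suff -> : x +i* s - (x +i* t) = 'i * (s - t)%:C.
  by rewrite cabsM cabs_i mul1r cabs_real.
by apply/eqP; rewrite eq_complex /= subrr !mul0r !mul1r subrr add0r !eqxx.
Qed.

Section Edges.
Variables (x1 x2 y1 y2 : R).
Hypotheses (hx : x1 <= x2) (hy : y1 <= y2).

Lemma on_bd_b t : x1 <= t <= x2 -> on_bd x1 x2 y1 y2 (t +i* y1).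
Proof. by move=> ht; rewrite /on_bd /in_rect /= ht lexx hy eqxx !orbT. Qed.

Lemma on_bd_t t : x1 <= t <= x2 -> on_bd x1 x2 y1 y2 (t +i* y2).
Proof. by move=> ht; rewrite /on_bd /in_rect /= ht lexx hy eqxx !orbT. Qed.

Lemma on_bd_l t : y1 <= t <= y2 -> on_bd x1 x2 y1 y2 (x1 +i* t).
Proof. by move=> ht; rewrite /on_bd /in_rect /= ht lexx hx eqxx. Qed.

Lemma on_bd_r t : y1 <= t <= y2 -> on_bd x1 x2 y1 y2 (x2 +i* t).
Proof. by move=> ht; rewrite /on_bd /in_rect /= ht lexx hx eqxx !orbT. Qed.

Lemma edges_cts f : bd_cts f x1 x2 y1 y2 ->
  [/\ cts_on x1 x2 (fun t => f (t +i* y1)), cts_on x1 x2 (fun t => f (t +i* y2)),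
      cts_on y1 y2 (fun t => f (x1 +i* t)) & cts_on y1 y2 (fun t => f (x2 +i* t))].
Proof.
move=> fc; split; [apply: h_cts|apply: h_cts|apply: v_cts|apply: v_cts] => t ht;
  apply: fc; [exact: on_bd_b|exact: on_bd_t|exact: on_bd_l|exact: on_bd_r].
Qed.

Lemma eq_rectint f g : (forall z, on_bd x1 x2 y1 y2 z -> f z = g z) ->
  rectint f x1 x2 y1 y2 = rectint g x1 x2 y1 y2.
Proof.
move=> fg; rewrite /rectint /hint /vint.
congr (_ - _ + 'i * (_ - _)); apply: eq_cint => t ht; apply: fg;
  [exact: on_bd_b|exact: on_bd_t|exact: on_bd_r|exact: on_bd_l].
Qed.

Lemma rectintD f g : bd_cts f x1 x2 y1 y2 -> bd_cts g x1 x2 y1 y2 ->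
  rectint (fun z => f z + g z) x1 x2 y1 y2 =
  rectint f x1 x2 y1 y2 + rectint g x1 x2 y1 y2.
Proof.
move=> /edges_cts[f1 f2 f3 f4] /edges_cts[g1 g2 g3 g4].
by rewrite /rectint /hint /vint !cintD//; ring.
Qed.

Lemma rectintZ k f : bd_cts f x1 x2 y1 y2 ->
  rectint (fun z => k * f z) x1 x2 y1 y2 = k * rectint f x1 x2 y1 y2.
Proof.
move=> /edges_cts[f1 f2 f3 f4].
by rewrite /rectint /hint /vint !cintZ//; ring.
Qed.

Lemma rectint_cst k : rectint (fun=> k) x1 x2 y1 y2 = 0.
Proof. by rewrite /rectint /hint /vint !cint_cst//; ring. Qed.

(** With [rectint_cst] this makes every affine function integrate to 0, as the local step of
    Goursat's lemma requires. *)
Lemma rectint_id : rectint id x1 x2 y1 y2 = 0.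
Proof.
have idc a b : cts_on a b (fun t : R => t%:C).
  by apply: (@h_cts id 0) => t _; exact: ccts_id.
have cstc a b (k : R[i]) : cts_on a b (fun=> k).
  by move=> t _ e e0; exists 1 => // s _; rewrite subrr cabs0.
have hE y : hint id y x1 x2 =
    ((x2 ^+ 2 - x1 ^+ 2) / 2)%:C + 'i * y%:C * (x2 - x1)%:C.
  rewrite /hint -cint_id// -cint_cst// -cintD//.
  by apply: eq_cint => t _; simpc.
have vE x : vint id x y1 y2 =
    x%:C * (y2 - y1)%:C + 'i * ((y2 ^+ 2 - y1 ^+ 2) / 2)%:C.
  rewrite /vint -cint_id// -cint_cst// -cintZ// -cintD//; last exact: cts_onZ.
  by apply: eq_cint => t _; simpc.
rewrite /rectint !hE !vE; apply/eqP; rewrite eq_complex /=.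
by apply/andP; split; apply/eqP; field.
Qed.

(** Each side contributes 2 * M times its length, hence 4 * M times the half-perimeter. *)
Lemma rectint_bound f M : bd_cts f x1 x2 y1 y2 ->
  (forall z, on_bd x1 x2 y1 y2 z -> cabs (f z) <= M) ->
  cabs (rectint f x1 x2 y1 y2) <= 4 * M * (x2 - x1 + (y2 - y1)).
Proof.
move=> /edges_cts[f1 f2 f3 f4] fM; rewrite /rectint.
apply: le_trans (ler_cabsD _ _) _; rewrite cabsM cabs_i mul1r.
apply: le_trans (lerD (ler_cabsB _ _) (ler_cabsB _ _)) _.
have b1 : cabs (hint f y1 x1 x2) <= 2 * M * (x2 - x1).
  by apply: cint_bound => // t ht; apply: fM; exact: on_bd_b.
have b2 : cabs (hint f y2 x1 x2) <= 2 * M * (x2 - x1).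
  by apply: cint_bound => // t ht; apply: fM; exact: on_bd_t.
have b3 : cabs (vint f x1 y1 y2) <= 2 * M * (y2 - y1).
  by apply: cint_bound => // t ht; apply: fM; exact: on_bd_l.
have b4 : cabs (vint f x2 y1 y2) <= 2 * M * (y2 - y1).
  by apply: cint_bound => // t ht; apply: fM; exact: on_bd_r.
lra.
Qed.

End Edges.

Lemma rectint_vcut f x1 x x2 y1 y2 : x1 <= x -> x <= x2 -> y1 <= y2 ->
  bd_cts f x1 x2 y1 y2 ->
  rectint f x1 x2 y1 y2 = rectint f x1 x y1 y2 + rectint f x x2 y1 y2.
Proof.
move=> h1 h2 hy /(edges_cts (le_trans h1 h2) hy)[f1 f2 _ _].
rewrite /rectint /hint (cint_chasles h1 h2 f1) (cint_chasles h1 h2 f2); ring.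
Qed.

Lemma rectint_hcut f x1 x2 y1 y y2 : x1 <= x2 -> y1 <= y -> y <= y2 ->
  bd_cts f x1 x2 y1 y2 ->
  rectint f x1 x2 y1 y2 = rectint f x1 x2 y1 y + rectint f x1 x2 y y2.
Proof.
move=> hx h1 h2 /(edges_cts hx (le_trans h1 h2))[_ _ f1 f2].
rewrite /rectint /vint (cint_chasles h1 h2 f1) (cint_chasles h1 h2 f2); ring.
Qed.

Lemma rectint_quarters f x1 x x2 y1 y y2 :
  x1 <= x -> x <= x2 -> y1 <= y -> y <= y2 ->
  (forall z, in_rect x1 x2 y1 y2 z -> ccts f z) ->
  rectint f x1 x2 y1 y2 = rectint f x1 x y1 y + rectint f x x2 y1 y +
    (rectint f x1 x y y2 + rectint f x x2 y y2).
Proof.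
move=> hx1 hx2 hy1 hy2 fc.
have fc' a b c d : x1 <= a -> b <= x2 -> y1 <= c -> d <= y2 -> bd_cts f a b c d.
  move=> ha hb hc hd z /andP[/andP[/andP[za zb] /andP[zc zd]] _]; apply: fc.
  by rewrite /in_rect (le_trans ha za) (le_trans zb hb) (le_trans hc zc) (le_trans zd hd).
rewrite (@rectint_hcut _ _ _ _ y)//; [|exact: le_trans hx2|exact: fc'].
by congr (_ + _); apply: rectint_vcut => //; exact: fc'.
Qed.

End RectangleIntegral.

(** * Goursat's lemma *)

Section Goursat.
Local Open Scope complex_scope.
Context {R : realType}.
Implicit Types (f g : R[i] -> R[i]) (x y : R) (z w : R[i]).

(** Every left endpoint lies below every right endpoint, so the supremum of the left endpoints is a
    common point. *)
Lemma nested_intervals (p : R) (X : nat -> R) :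
  0 <= p ->
  (forall n, X n <= X n.+1 /\ X n.+1 + p / 2 ^+ n.+1 <= X n + p / 2 ^+ n) ->
  exists x, forall n, X n <= x <= X n + p / 2 ^+ n.
Proof.
move=> p0 HX.
have p2 n : 0 <= p / 2 ^+ n by rewrite divr_ge0// exprn_ge0.
have mono n k : X n <= X (n + k)%N /\
    X (n + k)%N + p / 2 ^+ (n + k) <= X n + p / 2 ^+ n.
  elim: k => [|k [ih1 ih2]]; first by rewrite addn0.
  have [h1 h2] := HX (n + k)%N; rewrite addnS.
  by split; [exact: le_trans h1|exact: le_trans ih2].
have ub m n : X m <= X n + p / 2 ^+ n.
  have [h1 _] := mono m (n)%N; have [_ h2] := mono n (m)%N.
  rewrite (addnC n) in h2; apply: le_trans h1 (le_trans _ h2).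
  by rewrite lerDl.
have hs : has_sup (range X).
  split; first by exists (X 0%N); exists 0%N.
  by exists (X 0%N + p / 2 ^+ 0) => _ [m _ <-]; exact: ub.
exists (sup (range X)) => n; apply/andP; split.
  by apply: sup_upper_bound => //; exists n.
by apply: ge_sup; [case: hs|move=> _ [m _ <-]; exact: ub].
Qed.

(** The squared half-perimeter of the whole is four times that of a quarter, so if all four quarters
    satisfied the bound, the whole would too. *)
Lemma goursat_step f (e x y a b : R) : 0 <= a -> 0 <= b ->
  (forall z, in_rect x (x + (a + a)) y (y + (b + b)) z -> ccts f z) ->
  e * (a + a + (b + b)) ^+ 2 < cabs (rectint f x (x + (a + a)) y (y + (b + b))) ->
  exists x' y', [/\ x <= x', x' + a <= x + (a + a), y <= y', y' + b <= y + (b + b) &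
    e * (a + b) ^+ 2 < cabs (rectint f x' (x' + a) y' (y' + b))].
Proof.
move=> a0 b0 fc H; apply: contrapT => Hn.
have small x' y' : x <= x' -> x' + a <= x + (a + a) -> y <= y' -> y' + b <= y + (b + b) ->
    cabs (rectint f x' (x' + a) y' (y' + b)) <= e * (a + b) ^+ 2.
  by move=> h1 h2 h3 h4; rewrite leNgt; apply/negP => h; apply: Hn; exists x', y'.
have s1 := small x y; have s2 := small (x + a) y.
have s3 := small x (y + b); have s4 := small (x + a) (y + b).
rewrite -!addrA !lerDl !lexx in s1 s2 s3 s4.
rewrite !lerD2l !lerDl a0 b0 in s1 s2 s3 s4.
have {}s1 := s1 isT isT isT isT; have {}s2 := s2 isT isT isT isT.
have {}s3 := s3 isT isT isT isT; have {}s4 := s4 isT isT isT isT.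
move: H; rewrite (@rectint_quarters _ f x (x + a) _ y (y + b))//;
  rewrite ?lerDl ?lerD2l ?lerDl//.
apply/negP; rewrite -leNgt.
apply: le_trans (ler_cabsD _ _) _.
apply: le_trans (lerD (ler_cabsD _ _) (ler_cabsD _ _)) _.
have -> : e * (a + a + (b + b)) ^+ 2 = e * (a + b) ^+ 2 + e * (a + b) ^+ 2 +
  (e * (a + b) ^+ 2 + e * (a + b) ^+ 2) by ring.
by rewrite !lerD.
Qed.

(** Subtracting the affine approximation at z does not change the integral. With s the
    half-perimeter, what is left is at most e * s on the boundary, and [rectint_bound] supplies the
    second factor s. *)
Lemma rectint_local f z l (e d x1 x2 y1 y2 : R) : 0 <= e ->
  (forall w, cabs (w - z) < d -> cabs (f w - f z - l * (w - z)) <= e * cabs (w - z)) ->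
  (forall w, in_rect x1 x2 y1 y2 w -> ccts f w) ->
  in_rect x1 x2 y1 y2 z -> x2 - x1 + (y2 - y1) < d ->
  cabs (rectint f x1 x2 y1 y2) <= 4 * e * (x2 - x1 + (y2 - y1)) ^+ 2.
Proof.
move=> e0 H fc zin sd.
have /andP[/andP[zx1 zx2] /andP[zy1 zy2]] := zin.
have hx : x1 <= x2 by exact: le_trans zx2.
have hy : y1 <= y2 by exact: le_trans zy2.
pose A w := f z + l * (w - z).
pose g w := f w + (-1) * A w.
have Ac w : ccts A w.
  apply: ccts_add; first exact: ccts_cst.
  apply: ccts_mul; first exact: ccts_cst.
  by apply: ccts_add; [exact: ccts_id|exact: ccts_cst].
have gc : bd_cts g x1 x2 y1 y2.
  move=> w /andP[/fc h _]; apply: ccts_add => //.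
  by apply: ccts_mul; [exact: ccts_cst|exact: Ac].
have A0 : rectint A x1 x2 y1 y2 = 0.
  rewrite /A rectintD//; first last.
  - move=> w _; apply: ccts_mul; first exact: ccts_cst.
    by apply: ccts_add; [exact: ccts_id|exact: ccts_cst].
  - by move=> w _; exact: ccts_cst.
  rewrite rectint_cst// add0r rectintZ//; last first.
    by move=> w _; apply: ccts_add; [exact: ccts_id|exact: ccts_cst].
  rewrite (@rectintD _ _ _ _ _ hx hy id (fun=> - z)).
  - by rewrite rectint_id// rectint_cst// addr0 mulr0.
  - by move=> w _; exact: ccts_id.
  - by move=> w _; exact: ccts_cst.
have -> : rectint f x1 x2 y1 y2 = rectint g x1 x2 y1 y2.
  rewrite /g rectintD//; first last.
  - by move=> w _; apply: ccts_mul; [exact: ccts_cst|exact: Ac].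
  - by move=> w /andP[/fc].
  by rewrite rectintZ// ?A0 ?mulr0 ?addr0// => w _; exact: Ac.
set s := x2 - x1 + (y2 - y1).
rewrite (_ : 4 * e * s ^+ 2 = 4 * (e * s) * s); last by ring.
apply: rectint_bound => // w /andP[/andP[/andP[wx1 wx2] /andP[wy1 wy2]] _].
have ws : cabs (w - z) <= s.
  apply: le_trans (cabs_le_ReIm _) _; rewrite /s !raddfB.
  have : `|complex.Re w - complex.Re z| <= x2 - x1 by rewrite ler_norml; lra.
  have : `|complex.Im w - complex.Im z| <= y2 - y1 by rewrite ler_norml; lra.
  by move=> ? ?; rewrite lerD.
have -> : g w = f w - f z - l * (w - z) by rewrite /g /A; ring.
by apply: le_trans (H _ (le_lt_trans ws sd)) _; rewrite ler_wpM2l.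
Qed.

Lemma goursat f x1 x2 y1 y2 : x1 <= x2 -> y1 <= y2 ->
  (forall z, in_rect x1 x2 y1 y2 z -> exists l, cdiff f z l) ->
  rectint f x1 x2 y1 y2 = 0.
Proof.
move=> hx hy fd.
have fc z : in_rect x1 x2 y1 y2 z -> ccts f z.
  by move=> /fd[l]; exact: cdiff_ccts.
apply/eqP; rewrite -cabs_eq0 eq_le cabs_ge0 andbT leNgt; apply/negP => B0.
set B := cabs _ in B0.
pose p := x2 - x1; pose q := y2 - y1.
have p0 : 0 <= p by rewrite subr_ge0.
have q0 : 0 <= q by rewrite subr_ge0.
have pq0 : 0 < (p + q) ^+ 2 + 1 by rewrite ltr_wpDl// sqr_ge0.
(* The summand 1 covers the degenerate rectangle p = q = 0 and makes the inequality [eB] strict. *)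
pose e := B / ((p + q) ^+ 2 + 1).
have e0 : 0 < e by rewrite divr_gt0.
have eB : e * (p + q) ^+ 2 < B.
  by rewrite /e mulrAC ltr_pdivrMr// ltr_pM2l// ltrDl.
pose P n := p / 2 ^+ n; pose Q n := q / 2 ^+ n.
have PS n : P n = P n.+1 + P n.+1 by rewrite /P exprS; field; rewrite expf_neq0.
have QS n : Q n = Q n.+1 + Q n.+1 by rewrite /Q exprS; field; rewrite expf_neq0.
have P0 n : 0 <= P n by rewrite divr_ge0// exprn_ge0.
have Q0 n : 0 <= Q n by rewrite divr_ge0// exprn_ge0.
pose bad n (s : R * R) := [/\ x1 <= s.1, s.1 + P n <= x2, y1 <= s.2, s.2 + Q n <= y2 &
  e * (P n + Q n) ^+ 2 < cabs (rectint f s.1 (s.1 + P n) s.2 (s.2 + Q n))].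
(* Badness is a premise inside the existential, so that the choice is total in s and can be iterated
   without carrying proofs. *)
have step n s : exists s' : R * R, bad n s ->
    [/\ s.1 <= s'.1, s'.1 + P n.+1 <= s.1 + P n,
        s.2 <= s'.2, s'.2 + Q n.+1 <= s.2 + Q n & bad n.+1 s'].
  have [[b1 b2 b3 b4 b5]|nb] := pselect (bad n s); last by exists s.
  have [||x' [y' [h1 h2 h3 h4 h5]]] := @goursat_step f e s.1 s.2 _ _ (P0 n.+1) (Q0 n.+1).
  - move=> z; rewrite -PS -QS => /andP[/andP[z1 z2] /andP[z3 z4]]; apply: fc.
    by rewrite /in_rect (le_trans b1)// (le_trans z2)// (le_trans b3)// (le_trans z4).
  - by rewrite -PS -QS.
  exists (x', y') => _; rewrite -PS -QS in h2 h4; split => //=.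
  by split => //=; [exact: le_trans h1|exact: le_trans h2 _|exact: le_trans h3|
    exact: le_trans h4 _].
pose next n s := sval (cid (step n s)).
have nextP n s := svalP (cid (step n s)).
pose S := fix S n := if n is m.+1 then next m (S m) else (x1, y1).
have badS n : bad n (S n).
  elim: n => [|n /nextP[] //].
  by rewrite /bad /P /Q /= !expr0 !divr1 /p /q !(addrC x1) !(addrC y1) !subrK.
have [X HX] : exists x, forall n, (S n).1 <= x <= (S n).1 + P n.
  by apply: (nested_intervals p0) => n; have [h1 h2 _ _ _] := nextP _ _ (badS n).
have [Y HY] : exists y, forall n, (S n).2 <= y <= (S n).2 + Q n.
  by apply: (nested_intervals q0) => n; have [_ _ h1 h2 _] := nextP _ _ (badS n).
have zin : in_rect x1 x2 y1 y2 (X +i* Y).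
  have := HX 0%N; have := HY 0%N; rewrite /P /Q /= !expr0 !divr1 /p /q.
  by rewrite !(addrC x1) !(addrC y1) !subrK /in_rect /= => -> ->.
have [l fl] := fd _ zin.
(* A quarter of e cancels the factor 4 of [rectint_local] and contradicts badness exactly. *)
have e40 : 0 < e / 4 by rewrite divr_gt0.
have [d d0 H] := fl _ e40.
have [n nd] : exists n, P n + Q n < d.
  exists (Num.bound ((p + q) / d)).
  rewrite /P /Q -mulrDl ltr_pdivrMr ?exprn_gt0// mulrC -ltr_pdivrMr//.
  apply: lt_le_trans (archi_boundP _) _.
    by apply: divr_ge0; [exact: addr_ge0|exact: ltW].
  by rewrite -natrX ler_nat ltnW// ltn_expl.
have [b1 b2 b3 b4] := badS n.
apply/negP; rewrite -leNgt.
have := @rectint_local f (X +i* Y) l _ d (S n).1 ((S n).1 + P n) (S n).2 ((S n).2 + Q n) (ltW e40) H.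
rewrite (addrC _ (P n)) (addrC _ (Q n)) !addrK => H'.
rewrite (_ : e * _ = 4 * (e / 4) * (P n + Q n) ^+ 2); last by field.
apply: H' => //.
  move=> w /andP[/andP[z1 z2] /andP[z3 z4]]; apply: fc.
  rewrite addrC in z2; rewrite addrC in z4.
  by rewrite /in_rect (le_trans b1)// (le_trans z2)// (le_trans b3)// (le_trans z4).
by rewrite /in_rect /= (addrC (P n)) (addrC (Q n)) HX HY.
Qed.

End Goursat.

(** * Cauchy's formula *)

Section Cauchy.
Local Open Scope complex_scope.
Context {R : realType}.
Implicit Types (f g : R[i] -> R[i]) (x y : R) (z w : R[i]).

(** Cutting off a strip on each of the four sides leaves the small square about w. The strips do not
    contain w, so Goursat's lemma makes their integrals vanish. *)
Lemma rectint_shrink f w (x1 x2 y1 y2 e : R) : 0 < e ->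
  x1 <= complex.Re w - e -> complex.Re w + e <= x2 ->
  y1 <= complex.Im w - e -> complex.Im w + e <= y2 ->
  (forall z, in_rect x1 x2 y1 y2 z -> z != w -> exists l, cdiff f z l) ->
  rectint f x1 x2 y1 y2 = rectint f (complex.Re w - e) (complex.Re w + e)
                                    (complex.Im w - e) (complex.Im w + e).
Proof.
case: w => u v /= e0 hx1 hx2 hy1 hy2 fd.
have fc a b c d : x1 <= a -> b <= x2 -> y1 <= c -> d <= y2 ->
    (forall z, on_bd a b c d z -> z != u +i* v) -> bd_cts f a b c d.
  move=> ha hb hc hd H z zb.
  have /andP[/andP[/andP[z1 z2] /andP[z3 z4]] _] := zb.
  have [|l /cdiff_ccts //] := fd z _ (H _ zb).
  by rewrite /in_rect (le_trans ha z1) (le_trans z2 hb) (le_trans hc z3) (le_trans z4 hd).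
have g0 a b c d : a <= b -> c <= d -> x1 <= a -> b <= x2 -> y1 <= c -> d <= y2 ->
    (forall z, in_rect a b c d z -> z != u +i* v) -> rectint f a b c d = 0.
  move=> ab cd ha hb hc hd H; apply: goursat => // z zb.
  have /andP[/andP[z1 z2] /andP[z3 z4]] := zb.
  apply: fd; last exact: H.
  by rewrite /in_rect (le_trans ha z1) (le_trans z2 hb) (le_trans hc z3) (le_trans z4 hd).
rewrite (@rectint_vcut _ f x1 (u - e)); [|lra|lra|lra|]; last first.
  apply: fc => // -[p q] /andP[_ /= H]; apply/eqP => -[pu qv].
  by move: H; rewrite pu qv => /or4P[] /eqP; lra.
rewrite (@rectint_vcut _ f (u - e) (u + e)); [|lra|lra|lra|]; last first.
  apply: fc => // [-[p q] /andP[_ /= H]]; apply/eqP => -[pu qv].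
  by move: H; rewrite pu qv => /or4P[] /eqP; lra.
rewrite (@rectint_hcut _ f (u - e) (u + e) y1 (v - e)); [|lra|lra|lra|]; last first.
  apply: fc => // [-[p q] /andP[_ /= H]]; apply/eqP => -[pu qv].
  by move: H; rewrite pu qv => /or4P[] /eqP; lra.
rewrite (@rectint_hcut _ f (u - e) (u + e) (v - e) (v + e)); [|lra|lra|lra|]; last first.
  apply: fc => //.
  move=> -[p q] /andP[_ /= H]; apply/eqP => -[pu qv].
  by move: H; rewrite pu qv => /or4P[] /eqP; lra.
have -> : rectint f x1 (u - e) y1 y2 = 0.
  apply: g0; [lra|lra|lra|lra|lra|lra|].
  by move=> -[p q] /andP[/= H _]; apply/eqP => -[pu qv]; lra.
have -> : rectint f (u + e) x2 y1 y2 = 0.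
  apply: g0; [lra|lra|lra|lra|lra|lra|].
  by move=> -[p q] /andP[/= H _]; apply/eqP => -[pu qv]; lra.
have -> : rectint f (u - e) (u + e) y1 (v - e) = 0.
  apply: g0; [lra|lra|lra|lra|lra|lra|].
  by move=> -[p q] /andP[/= _ H]; apply/eqP => -[pu qv]; lra.
have -> : rectint f (u - e) (u + e) (v + e) y2 = 0.
  apply: g0; [lra|lra|lra|lra|lra|lra|].
  by move=> -[p q] /andP[/= _ H]; apply/eqP => -[pu qv]; lra.
by rewrite !add0r !addr0.
Qed.

Lemma ccts_kernel w n z : z != w -> ccts (fun u => ((u - w) ^+ n)^-1) z.
Proof.
move=> zw; apply: ccts_inv; last by rewrite expf_neq0// subr_eq0.
elim: n => [|n ih]; first by apply: ccts_cst.
apply: (@ccts_near _ (fun u => (u - w) * (u - w) ^+ n)).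
  apply: ccts_mul => //; apply: ccts_add; [exact: ccts_id|exact: ccts_cst].
by exists 1 => // u _; rewrite exprS.
Qed.

(** The quotient is differentiable away from w and bounded near w, so shrinking the contour to a
    square of half-side h makes the integral O(h). *)
Lemma slope_rectint f w x1 x2 y1 y2 :
  x1 < complex.Re w < x2 -> y1 < complex.Im w < y2 ->
  (forall z, in_rect x1 x2 y1 y2 z -> exists l, cdiff f z l) ->
  rectint (fun z => (f z - f w) / (z - w)) x1 x2 y1 y2 = 0.
Proof.
move=> /andP[hx1 hx2] /andP[hy1 hy2] fd.
set q := fun z => _.
have qd z : in_rect x1 x2 y1 y2 z -> z != w -> exists l, cdiff q z l.
  move=> /fd[l fl] zw.
  have c1 : cdiff (fun z => f z - f w) z (l + 0) by apply: cdiff_add => //; exact: cdiff_cst.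
  have c2 : cdiff (fun z => z - w) z (1 + 0).
    by apply: cdiff_add; [exact: cdiff_id|exact: cdiff_cst].
  have c3 := cdiff_inv c2; rewrite subr_eq0 in c3.
  by eexists; exact: cdiff_mul c1 (c3 zw).
have [l fl] : exists l, cdiff f w l.
  by apply: fd; rewrite /in_rect !ltW.
have [d d0 H] := fl 1 ltr01.
have K0 : 0 <= 1 + cabs l by rewrite addr_ge0// cabs_ge0.
apply/eqP; rewrite -cabs_eq0 eq_le cabs_ge0 andbT.
apply/ler_addgt0Pr => e e0; rewrite add0r.
(* In the square |z - w| <= 2 * h < d. There the quotient is at most 1 + |l|, and the half-perimeter
   4 * h gives an integral of at most 16 * (1 + |l|) * h <= e. The remaining minima keep the square
   inside the rectangle. *)
pose h := Num.min (Num.min (d / 3) (e / (16 * (1 + cabs l)))) (Num.min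
  (Num.min (complex.Re w - x1) (x2 - complex.Re w))
  (Num.min (complex.Im w - y1) (y2 - complex.Im w))).
have K1 : 0 < 1 + cabs l by rewrite ltr_pwDl// cabs_ge0.
have h0 : 0 < h.
  rewrite /h !lt_min !subr_gt0 hx1 hx2 hy1 hy2 !andbT divr_gt0//=.
  by rewrite divr_gt0// mulr_gt0.
have [hd he] : h <= d / 3 /\ h <= e / (16 * (1 + cabs l)).
  by rewrite /h !ge_min !lexx /= ?orbT.
have : h <= Num.min (Num.min (complex.Re w - x1) (x2 - complex.Re w))
  (Num.min (complex.Im w - y1) (y2 - complex.Im w)) by rewrite ge_min lexx orbT.
rewrite !le_min => /andP[/andP[h1 h2] /andP[h3 h4]].
rewrite (@rectint_shrink q w _ _ _ _ h h0); [|lra|lra|lra|lra|exact: qd].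
have bd_ne z : on_bd (complex.Re w - h) (complex.Re w + h)
    (complex.Im w - h) (complex.Im w + h) z -> z != w.
  move=> /andP[_ H']; apply/eqP => zw.
  by move: H'; rewrite zw => /or4P[] /eqP; lra.
have bd : bd_cts q (complex.Re w - h) (complex.Re w + h)
    (complex.Im w - h) (complex.Im w + h).
  move=> z zb; have /andP[/andP[/andP[z1 z2] /andP[z3 z4]] _] := zb.
  have [||m /cdiff_ccts//] := qd z; last exact: bd_ne.
  by rewrite /in_rect; apply/andP; split; apply/andP; split; lra.
apply: le_trans (@rectint_bound _ _ _ _ _ _ _ q (1 + cabs l) bd _) _; try lra.
- move=> z zb; have zw := bd_ne _ zb.
  have /andP[/andP[/andP[z1 z2] /andP[z3 z4]] _] := zb.
  have zd : cabs (z - w) < d.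
    apply: le_lt_trans (cabs_le_ReIm _) _; rewrite !raddfB.
    have : `|complex.Re z - complex.Re w| <= h by rewrite ler_norml; lra.
    have : `|complex.Im z - complex.Im w| <= h by rewrite ler_norml; lra.
    lra.
  rewrite /q cabsM cabsV ler_pdivrMr ?cabs_gt0 ?subr_eq0//.
  have -> : f z - f w = (f z - f w - l * (z - w)) + l * (z - w) by ring.
  apply: le_trans (ler_cabsD _ _) _; rewrite cabsM mulrDl lerD2r.
  exact: H.
- move: he; rewrite ler_pdivlMr ?mulr_gt0//; lra.
Qed.

Section Kernel.
Variables (x1 x2 y1 y2 : R).
Hypotheses (hx : x1 <= x2) (hy : y1 <= y2).
Local Notation bd := (on_bd x1 x2 y1 y2).
Local Notation J f := (rectint f x1 x2 y1 y2).

(** Differentiation under the integral sign, from a remainder that is quadratic in w - w0 uniformly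
    along the contour. *)
Lemma kernel_cdiff (k : R[i] -> R[i] -> R[i]) (k' : R[i] -> R[i]) w0 (A rho : R) :
  0 < rho ->
  (forall w, cabs (w - w0) < rho -> bd_cts (k w) x1 x2 y1 y2) ->
  bd_cts k' x1 x2 y1 y2 ->
  (forall w z, cabs (w - w0) < rho -> bd z ->
     cabs (k w z - k w0 z - (w - w0) * k' z) <= A * cabs (w - w0) ^+ 2) ->
  cdiff (fun w => J (k w)) w0 (J k').
Proof.
move=> rho0 kc k'c kA.
pose B := 4 * A * (x2 - x1 + (y2 - y1)).
have B1 : 0 < 1 + `|B| by rewrite ltr_pwDl.
move=> e e0; exists (Num.min rho (e / (1 + `|B|))).
  by rewrite lt_min rho0 divr_gt0.
move=> w; rewrite lt_min => /andP[wr]; rewrite ltr_pdivlMr// => we.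
have c0 : cabs (w0 - w0) < rho by rewrite subrr cabs0.
have cm : bd_cts (fun z => (-1) * k w0 z) x1 x2 y1 y2.
  by move=> z zb; apply: ccts_mul; [exact: ccts_cst|exact: kc].
have cm' : bd_cts (fun z => (- (w - w0)) * k' z) x1 x2 y1 y2.
  by move=> z zb; apply: ccts_mul; [exact: ccts_cst|exact: k'c].
have cs : bd_cts (fun z => (-1) * k w0 z + (- (w - w0)) * k' z) x1 x2 y1 y2.
  by move=> z zb; apply: ccts_add; [exact: cm|exact: cm'].
have -> : J (k w) - J (k w0) - J k' * (w - w0) =
    J (fun z => k w z + ((-1) * k w0 z + (- (w - w0)) * k' z)).
  rewrite rectintD//; last exact: kc.
  by rewrite rectintD// !rectintZ//; [ring|exact: kc].
apply: le_trans (@rectint_bound _ _ _ _ _ hx hy _ (A * cabs (w - w0) ^+ 2) _ _) _.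
- by move=> z zb; apply: ccts_add; [exact: kc|exact: cs].
- move=> z zb; apply: le_trans (kA _ _ wr zb).
  by rewrite le_eqVlt; apply/orP; left; apply/eqP; congr cabs; ring.
rewrite (_ : 4 * _ * _ = B * cabs (w - w0) * cabs (w - w0)); last by rewrite /B; ring.
rewrite ler_wpM2r ?cabs_ge0//.
apply: le_trans (ltW we); rewrite mulrC ler_wpM2l ?cabs_ge0//.
by rewrite (le_trans (ler_norm _))// lerDr.
Qed.

(** For n = 1 this is the Cauchy integral without the factor 1 / (2 pi i); n = 2 gives its
    derivative in w. *)
Definition cauchy_int n f w := J (fun z => f z / (z - w) ^+ n).

Lemma far_ne w z (rho : R) : 0 < rho -> rho <= cabs (z - w) -> z != w.
Proof.
move=> r0 zr; rewrite -subr_eq0 -cabs_gt0; exact: lt_le_trans zr.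
Qed.

Lemma kernel_cts n f w (rho : R) : 0 < rho -> bd_cts f x1 x2 y1 y2 ->
  (forall z, bd z -> rho <= cabs (z - w)) ->
  bd_cts (fun z => f z / (z - w) ^+ n) x1 x2 y1 y2.
Proof.
move=> r0 fc far z zb; apply: ccts_mul; first exact: fc.
by apply: ccts_kernel; apply: far_ne (far _ zb).
Qed.

(** Only the values of f on the boundary enter, so the lemma serves both for G and, with f = 1, for
    N. *)
Lemma cauchy_int_cdiff f M w0 (rho : R) : 0 < rho -> bd_cts f x1 x2 y1 y2 ->
  (forall z, bd z -> cabs (f z) <= M) ->
  (forall z, bd z -> rho <= cabs (z - w0)) ->
  cdiff (cauchy_int 1 f) w0 (cauchy_int 2 f w0) /\
  exists l, cdiff (cauchy_int 2 f) w0 l.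
Proof.
move=> r0 fc fM far.
have r20 : 0 < rho / 2 by rewrite divr_gt0.
have near w z : cabs (w - w0) < rho / 2 -> bd z -> rho / 2 <= cabs (z - w).
  move=> wr /far zr; have := ler_cabs_dist w z w0; lra.
have inv_far z n : bd z -> (cabs (z - w0) ^+ n)^-1 <= (rho ^+ n)^-1.
  move=> /far zr; have zr0 := lt_le_trans r0 zr.
  by rewrite lef_pV2 ?posrE ?exprn_gt0// lerXn2r// nnegrE ltW.
have inv_near w z n : cabs (w - w0) < rho / 2 -> bd z ->
    (cabs (z - w) ^+ n)^-1 <= ((rho / 2) ^+ n)^-1.
  move=> wr zb; have zr := near _ _ wr zb; have zr0 := lt_le_trans r20 zr.
  by rewrite lef_pV2 ?posrE ?exprn_gt0// lerXn2r// nnegrE ltW.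
have kc n w : cabs (w - w0) < rho / 2 ->
    bd_cts (fun z => f z / (z - w) ^+ n) x1 x2 y1 y2.
  by move=> wr; exact: (@kernel_cts n f w _ r20 fc (fun z => near w z wr)).
have kc0 n : bd_cts (fun z => f z / (z - w0) ^+ n) x1 x2 y1 y2.
  exact: (@kernel_cts n f w0 _ r0 fc far).
split.
  apply: (@kernel_cdiff _ _ _ (M * ((rho ^+ 2)^-1 * ((rho / 2) ^+ 1)^-1)) _ r20) => //.
    by move=> w wr; exact: kc.
  move=> w z wr zb.
  have zw0 := far_ne r0 (far _ zb); have zw := far_ne r20 (near _ _ wr zb).
  have -> : f z / (z - w) ^+ 1 - f z / (z - w0) ^+ 1 - (w - w0) * (f z / (z - w0) ^+ 2)
     = f z * (((z - w0) ^+ 2)^-1 * ((z - w) ^+ 1)^-1) * (w - w0) ^+ 2.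
    by field; rewrite !subr_eq0 zw0 zw.
  rewrite cabsM (cabsM (f z)) (cabsX (w - w0)) ler_wpM2r ?exprn_ge0 ?cabs_ge0//.
  rewrite (cabsM (_ ^-1)) !cabsV !cabsX; apply: ler_pM => //; rewrite ?cabs_ge0//.
  - by rewrite mulr_ge0 ?invr_ge0 ?exprn_ge0 ?cabs_ge0.
  - exact: fM.
  - by apply: ler_pM; rewrite ?invr_ge0 ?exprn_ge0 ?cabs_ge0//;
      [exact: inv_far|exact: inv_near].
exists (J (fun z => 2 * (f z / (z - w0) ^+ 3))).
(* With a = z - w0 and h = w - w0, the remainder of the kernel is h^2 * (3 * a - 2 * h) / (a^3 * (a
   - h)^2). The two summands of B bound its two terms, using |2 * h| <= rho and |a - h| >= rho /
   2. *)
pose B := 3 * (rho ^+ 2)^-1 * ((rho / 2) ^+ 2)^-1 + rho * ((rho ^+ 3)^-1 * ((rho / 2) ^+ 2)^-1).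
apply: (@kernel_cdiff _ _ _ (M * B) _ r20) => //.
- by move=> w wr; exact: kc.
- by move=> z zb; apply: ccts_mul; [exact: ccts_cst|exact: kc0].
move=> w z wr zb.
have zw0 := far_ne r0 (far _ zb); have zw := far_ne r20 (near _ _ wr zb).
have -> : f z / (z - w) ^+ 2 - f z / (z - w0) ^+ 2 - (w - w0) * (2 * (f z / (z - w0) ^+ 3))
   = f z * (3 * ((z - w0) ^+ 2)^-1 * ((z - w) ^+ 2)^-1
       - 2 * (w - w0) * (((z - w0) ^+ 3)^-1 * ((z - w) ^+ 2)^-1)) * (w - w0) ^+ 2.
  by field; rewrite !subr_eq0 zw0 zw.
rewrite cabsM (cabsM (f z)) (cabsX (w - w0)) ler_wpM2r ?exprn_ge0 ?cabs_ge0//.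
apply: ler_pM => //; rewrite ?cabs_ge0//; first exact: fM.
have c2 : cabs (2 : R[i]) = 2 by rewrite -(rmorph_nat (real_complex R)) cabs_real normr_nat.
have c3 : cabs (3 : R[i]) = 3 by rewrite -(rmorph_nat (real_complex R)) cabs_real normr_nat.
apply: le_trans (ler_cabsB _ _) _; rewrite !cabsM c2 c3 !cabsV !cabsX.
have P n u : 0 <= (cabs u ^+ n)^-1 by rewrite invr_ge0 exprn_ge0 ?cabs_ge0.
apply: lerD.
  rewrite -!mulrA ler_wpM2l//; apply: ler_pM; rewrite ?P//; [exact: inv_far|exact: inv_near].
apply: ler_pM; rewrite ?mulr_ge0 ?P ?cabs_ge0//; first by lra.
by apply: ler_pM; rewrite ?P//; [exact: inv_far|exact: inv_near].
Qed.

End Kernel.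
End Cauchy.

(** * Cauchy's formula and estimates on a disc *)

Section CauchyEstimate.
Local Open Scope complex_scope.
Context {R : realType}.
Implicit Types (f : R[i] -> R[i]) (z w a : R[i]) (s r : R).

Lemma ReB z w : complex.Re (z - w) = complex.Re z - complex.Re w.
Proof. by case: z w => [? ?] []. Qed.

Lemma ImB z w : complex.Im (z - w) = complex.Im z - complex.Im w.
Proof. by case: z w => [? ?] []. Qed.

Lemma Re_inv z : complex.Re z^-1 = complex.Re z / (complex.Re z ^+ 2 + complex.Im z ^+ 2).
Proof. by case: z. Qed.

Lemma Im_inv z : complex.Im z^-1 = - (complex.Im z / (complex.Re z ^+ 2 + complex.Im z ^+ 2)).
Proof. by case: z. Qed.

(** The denominator is at most 2 * (3 * s / 2)^2 = 9 * s^2 / 2. The case of denominator 0 is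
    excluded by the caller, where p^2 <= q^2 + t^2 and p > 0. *)
Lemma frac_lower (p q t s : R) : 0 < s -> s / 2 <= p -> `|q| <= 3 * s / 2 -> `|t| <= 3 * s / 2 ->
  (9 * s)^-1 <= p / (q ^+ 2 + t ^+ 2) \/ q ^+ 2 + t ^+ 2 = 0.
Proof.
move=> s0 ps hq ht.
have [->|D0] := eqVneq (q ^+ 2 + t ^+ 2) 0; [by right|left].
have D1 : 0 < q ^+ 2 + t ^+ 2 by rewrite lt_neqAle eq_sym D0 addr_ge0 ?sqr_ge0.
have s90 : 0 < 9 * s by rewrite mulr_gt0.
rewrite ler_pdivlMr// mulrC ler_pdivrMr//.
have q2 : q ^+ 2 <= (3 * s / 2) ^+ 2.
  by rewrite -(real_normK (num_real q)) lerXn2r// ?nnegrE// (le_trans _ hq).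
have t2 : t ^+ 2 <= (3 * s / 2) ^+ 2.
  by rewrite -(real_normK (num_real t)) lerXn2r// ?nnegrE// (le_trans _ ht).
have : s / 2 * (9 * s) <= p * (9 * s) by rewrite ler_wpM2r// ltW.
move: q2 t2; rewrite !expr2; lra.
Qed.

Definition sq_bd a s := on_bd (complex.Re a - s) (complex.Re a + s)
                              (complex.Im a - s) (complex.Im a + s).
Definition sqint a s f := rectint f (complex.Re a - s) (complex.Re a + s)
                              (complex.Im a - s) (complex.Im a + s).

Lemma sq_le a s : 0 < s -> complex.Re a - s <= complex.Re a + s /\
  complex.Im a - s <= complex.Im a + s.
Proof. by move=> s0; split; lra. Qed.

Lemma sq_near a s z : in_rect (complex.Re a - s) (complex.Re a + s)
    (complex.Im a - s) (complex.Im a + s) z -> cabs (z - a) <= 2 * s.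
Proof.
move=> /andP[/andP[z1 z2] /andP[z3 z4]].
apply: le_trans (cabs_le_ReIm _) _; rewrite ?ReB ?ImB.
have : `|complex.Re z - complex.Re a| <= s by rewrite ler_norml; lra.
have : `|complex.Im z - complex.Im a| <= s by rewrite ler_norml; lra.
lra.
Qed.

Lemma sq_far a s z w : cabs (w - a) <= s / 2 -> sq_bd a s z -> s / 2 <= cabs (z - w).
Proof.
move=> wa /andP[_ zb].
have wr := le_trans (normr_Re_cabs _) wa; have wi := le_trans (normr_Im_cabs _) wa.
rewrite ?ReB ?ImB !ler_norml in wr wi.
have hr : s / 2 <= `|complex.Re (z - w)| -> s / 2 <= cabs (z - w).
  by move=> h; exact: le_trans h (normr_Re_cabs _).
have hi : s / 2 <= `|complex.Im (z - w)| -> s / 2 <= cabs (z - w).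
  by move=> h; exact: le_trans h (normr_Im_cabs _).
move: zb => /or4P[] /eqP zb; [apply: hr|apply: hr|apply: hi|apply: hi];
  rewrite ?ReB ?ImB zb /= ler_normr; apply/orP; [right|left|right|left]; lra.
Qed.

(* Each of the four sides contributes at least [2 / 9] to the imaginary part. *)
Lemma winding_lower a s w : 0 < s -> cabs (w - a) <= s / 2 ->
  2^-1 <= cabs (sqint a s (fun z => 1 / (z - w) ^+ 1)).
Proof.
move=> s0 wa; have [hx hy] := sq_le a s0.
have s20 : 0 < s / 2 by rewrite divr_gt0.
have bc : bd_cts (fun z => 1 / (z - w) ^+ 1) (complex.Re a - s) (complex.Re a + s)
    (complex.Im a - s) (complex.Im a + s).
  have oc : bd_cts (fun=> 1 : R[i]) (complex.Re a - s) (complex.Re a + s)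
      (complex.Im a - s) (complex.Im a + s) by move=> z _; exact: ccts_cst.
  exact: (@kernel_cts _ _ _ _ _ 1 _ w _ s20 oc (fun z => sq_far wa)).
have wr := le_trans (normr_Re_cabs _) wa; have wi := le_trans (normr_Im_cabs _) wa.
rewrite ReB ler_norml in wr; rewrite ImB ler_norml in wi.
apply: le_trans (normr_Im_cabs _); apply: le_trans (ler_norm _).
have [e1 e2 e3 e4] := edges_cts hx hy bc.
have side (k : R[i]) (g : R -> R[i]) c : cts_on (c - s) (c + s) g ->
    (forall t, c - s <= t <= c + s -> (9 * s)^-1 <= complex.Im (k * g t)) ->
    2 / 9 <= complex.Im (k * cint (c - s) (c + s) g).
  move=> gc gm; rewrite -cintZ//.
  have -> : 2 / 9 = (9 * s)^-1 * (c + s - (c - s)) by field; rewrite gt_eqF.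
  by apply: cint_Im_ge; [lra|exact: cts_onZ|].
have inv_ge (p q t : R) : s / 2 <= p -> `|q| <= 3 * s / 2 -> `|t| <= 3 * s / 2 ->
    p ^+ 2 <= q ^+ 2 + t ^+ 2 -> (9 * s)^-1 <= p / (q ^+ 2 + t ^+ 2).
  move=> ps hq ht pqt; have [//|D0] := frac_lower s0 ps hq ht.
  have : 0 < p ^+ 2 by rewrite exprn_gt0// (lt_le_trans s20).
  by rewrite D0 in pqt; lra.
pose K z : R[i] := 1 / (z - w) ^+ 1.
have KRe z : complex.Re (K z) =
    complex.Re (z - w) / (complex.Re (z - w) ^+ 2 + complex.Im (z - w) ^+ 2).
  by rewrite /K expr1 mul1r Re_inv.
have KIm z : complex.Im (K z) =
    - complex.Im (z - w) / (complex.Re (z - w) ^+ 2 + complex.Im (z - w) ^+ 2).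
  by rewrite /K expr1 mul1r Im_inv mulNr.
have iN (z : R[i]) : complex.Im ('i * z) = complex.Re z by case: z => p q /=; ring.
have iN' (z : R[i]) : complex.Im (- 'i * z) = - complex.Re z by case: z => p q /=; ring.
have i1 (z : R[i]) : complex.Im (-1 * z) = - complex.Im z by case: z => p q /=; ring.
have b1 : 2 / 9 <= complex.Im (1 * hint K (complex.Im a - s) (complex.Re a - s) (complex.Re a + s)).
  apply: side => // t ht; rewrite mul1r KIm !ReB !ImB /=.
  by apply: inv_ge; rewrite ?ler_norml; [lra|lra|lra|rewrite sqrrN lerDr sqr_ge0].
have b2 : 2 / 9 <= complex.Im (-1 * hint K (complex.Im a + s) (complex.Re a - s) (complex.Re a + s)).
  apply: side => // t ht; rewrite i1 KIm -mulNr opprK !ReB !ImB /=.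
  by apply: inv_ge; rewrite ?ler_norml; [lra|lra|lra|rewrite lerDr sqr_ge0].
have b3 : 2 / 9 <= complex.Im ('i * vint K (complex.Re a + s) (complex.Im a - s) (complex.Im a + s)).
  apply: side => // t ht; rewrite iN KRe !ReB !ImB /=.
  by apply: inv_ge; rewrite ?ler_norml; [lra|lra|lra|rewrite lerDl sqr_ge0].
have b4 : 2 / 9 <= complex.Im (- 'i * vint K (complex.Re a - s) (complex.Im a - s) (complex.Im a + s)).
  apply: side => // t ht; rewrite iN' KRe -mulNr !ReB !ImB /=.
  by apply: inv_ge; rewrite ?ler_norml; [lra|lra|lra|rewrite sqrrN lerDl sqr_ge0].
(* The nested differences let [ImB] and [ImN] split the integral into its four sides, whose total is
   at least 8 / 9. *)
have -> : sqint a s K = 1 * hint K (complex.Im a - s) (complex.Re a - s) (complex.Re a + s) -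
    (- (-1 * hint K (complex.Im a + s) (complex.Re a - s) (complex.Re a + s))) -
    (- ('i * vint K (complex.Re a + s) (complex.Im a - s) (complex.Im a + s))) -
    (- (- 'i * vint K (complex.Re a - s) (complex.Im a - s) (complex.Im a + s))).
  by rewrite /sqint /rectint; ring.
have ImN (z : R[i]) : complex.Im (- z) = - complex.Im z by case: z.
rewrite !ImB !ImN; lra.
Qed.

Section Disc.
Variables (f : R[i] -> R[i]) (f' : R[i] -> R[i]) (a : R[i]) (r M : R).
Hypothesis r0 : 0 < r.
Hypothesis fd : forall z, cabs (z - a) < r -> cdiff f z (f' z).
Hypothesis fM : forall z, cabs (z - a) < r -> cabs (f z) <= M.

(** The square of half-side s lies within distance 2 * s = r / 2 of a, hence inside the disc. *)
Let s := r / 4.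

Let s0 : 0 < s. Proof. by rewrite divr_gt0. Qed.
Let s20 : 0 < s / 2. Proof. by rewrite divr_gt0. Qed.

Let sq_in z : in_rect (complex.Re a - s) (complex.Re a + s)
    (complex.Im a - s) (complex.Im a + s) z -> cabs (z - a) < r.
Proof.
move=> /sq_near h; apply: le_lt_trans h _; rewrite /s.
have := r0; lra.
Qed.

Let bd_in z : sq_bd a s z -> cabs (z - a) < r.
Proof. by move=> /andP[/sq_in]. Qed.

Let fc : bd_cts f (complex.Re a - s) (complex.Re a + s)
    (complex.Im a - s) (complex.Im a + s).
Proof. by move=> z /bd_in /fd /cdiff_ccts. Qed.

Let oc (k : R[i]) : bd_cts (fun=> k) (complex.Re a - s) (complex.Re a + s)
    (complex.Im a - s) (complex.Im a + s).
Proof. by move=> z _; exact: ccts_cst. Qed.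

Let hx := (sq_le a s0).1.
Let hy := (sq_le a s0).2.

Local Notation CI n g := (cauchy_int (complex.Re a - s) (complex.Re a + s)
  (complex.Im a - s) (complex.Im a + s) n g).

Let wd_in w : cabs (w - a) <= s / 2 ->
  (complex.Re a - s < complex.Re w < complex.Re a + s) /\
  (complex.Im a - s < complex.Im w < complex.Im a + s).
Proof.
move=> wa; have := s0.
have := le_trans (normr_Re_cabs _) wa; have := le_trans (normr_Im_cabs _) wa.
rewrite ReB ImB !ler_norml => /andP[? ?] /andP[? ?] ?.
by split; apply/andP; split; lra.
Qed.

Let kc g n w : cabs (w - a) <= s / 2 ->
  bd_cts g (complex.Re a - s) (complex.Re a + s) (complex.Im a - s) (complex.Im a + s) ->
  bd_cts (fun z => g z / (z - w) ^+ n) (complex.Re a - s) (complex.Re a + s)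
    (complex.Im a - s) (complex.Im a + s).
Proof.
by move=> wa gc; exact: (@kernel_cts _ _ _ _ _ n g w _ s20 gc (fun z => sq_far wa)).
Qed.

Lemma cauchy_formula w : cabs (w - a) <= s / 2 -> CI 1 f w = f w * CI 1 (fun=> 1) w.
Proof.
move=> wa; have [wx wy] := wd_in wa; apply/eqP; rewrite -subr_eq0 -(mulNr (f w)).
have <- := @slope_rectint _ f w _ _ _ _ wx wy (fun z zi => ex_intro _ _ (fd (sq_in zi))).
have kc1 := kc 1 wa (oc 1).
rewrite /cauchy_int -rectintZ// -rectintD//.
- apply/eqP; apply: eq_rectint => // z _; rewrite expr1; ring.
- exact: kc.
- by move=> z zb; apply: ccts_mul; [exact: ccts_cst|exact: kc1].
Qed.

Let N_neq0 w : cabs (w - a) <= s / 2 -> CI 1 (fun=> 1) w != 0.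
Proof.
move=> wa; rewrite -cabs_gt0; apply: lt_le_trans (winding_lower s0 wa).
by rewrite invr_gt0.
Qed.

(** Near a, f' = (G' - f * N') / N, and every function on the right is differentiable at a. *)
Lemma deriv_cdiff : exists l, cdiff f' a l.
Proof.
have far0 w : cabs (w - a) <= s / 2 -> forall z, sq_bd a s z -> s / 2 <= cabs (z - w).
  by move=> wa z; exact: sq_far.
have Gd w (wa : cabs (w - a) <= s / 2) := cauchy_int_cdiff hx hy s20 fc
  (fun z zb => fM (bd_in zb)) (far0 w wa).
have o1 z : sq_bd a s z -> cabs ((fun=> 1 : R[i]) z) <= 1 by rewrite cabs1.
have Nd w (wa : cabs (w - a) <= s / 2) := cauchy_int_cdiff hx hy s20 (oc 1) o1 (far0 w wa).
have a0 : cabs (a - a) <= s / 2 by rewrite subrr cabs0 ltW.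
have [_ [l2 G2]] := Gd a a0; have [N1 [m2 N2]] := Nd a a0.
have fa : cdiff f a (f' a) by apply: fd; rewrite subrr cabs0.
have c1 := cdiff_mul fa N2.
have c2 := cdiff_mul (cdiff_cst (-1) a) c1.
have c3 := cdiff_mul (cdiff_add G2 c2) (cdiff_inv N1 (N_neq0 a0)).
eexists; apply: (cdiff_near c3); exists (s / 4); first by rewrite divr_gt0.
move=> w wa; have wa' : cabs (w - a) <= s / 2.
  by apply: le_trans (ltW wa) _; have := s0; lra.
have [G1 _] := Gd w wa'; have [N1w _] := Nd w wa'.
have wr : cabs (w - a) < r by apply: lt_trans wa _; rewrite /s; have := r0; lra.
have P := cdiff_mul (fd wr) N1w.
(* G = f * N holds on a whole neighbourhood of w, because |w - a| < s / 4 leaves room s / 4 below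
   the radius s / 2. Both expressions for the derivative of G at w therefore agree. *)
have /(cdiff_uniq P) E : cdiff (fun w => f w * CI 1 (fun=> 1) w) w (CI 2 f w).
  apply: (cdiff_near G1); exists (s / 4); first by rewrite divr_gt0.
  move=> u uw; apply: cauchy_formula.
  apply: le_trans (ler_cabs_dist w _ _) _; lra.
by rewrite -E; field; exact: N_neq0.
Qed.

(** Applying the formula to f - f(a) at both w and a gives (f(w) - f(a)) * N(w) as one integral
    whose kernel contains the factor w - a; the term at a vanishes, so N(a) does not appear. *)
Lemma disc_lipschitz w : cabs (w - a) <= r / 8 ->
  cabs (f w - f a) <= 1024 * M / r * cabs (w - a).
Proof.
have -> : r / 8 = s / 2 by rewrite /s; field.
move=> wa; have a0 : cabs (a - a) <= s / 2 by rewrite subrr cabs0 ltW.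
have ar : cabs (a - a) < r by rewrite subrr cabs0.
have Ew := cauchy_formula wa; have Ea := cauchy_formula a0.
have M0 : 0 <= M by apply: le_trans (fM ar); exact: cabs_ge0.
pose k z := (f z - f a) * ((w - a) / ((z - w) * (z - a))).
have kcts : bd_cts k (complex.Re a - s) (complex.Re a + s)
    (complex.Im a - s) (complex.Im a + s).
  move=> z zb; apply: (@ccts_near _ (fun z => ((f z + - f a) * (w - a)) *
      ((1 / (z - w) ^+ 1) * (1 / (z - a) ^+ 1)))).
    apply: ccts_mul.
      apply: ccts_mul; last exact: ccts_cst.
      by apply: ccts_add; [exact: fc|exact: ccts_cst].
    by apply: ccts_mul; [exact: (kc 1 wa (oc 1))|exact: (kc 1 a0 (oc 1))].
  exists 1 => // u _; rewrite /k !expr1 !mul1r invfM; ring.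
have key : (f w - f a) * CI 1 (fun=> 1) w = rectint k (complex.Re a - s) (complex.Re a + s)
    (complex.Im a - s) (complex.Im a + s).
  have -> : (f w - f a) * CI 1 (fun=> 1) w =
      CI 1 f w + (- f a) * CI 1 (fun=> 1) w + ((-1) * (CI 1 f a + (- f a) * CI 1 (fun=> 1) a)).
    by rewrite Ew Ea; ring.
  have kw1 := kc 1 wa (oc 1); have ka1 := kc 1 a0 (oc 1).
  have kwf := kc 1 wa fc; have kaf := kc 1 a0 fc.
  have lin (c : R[i]) g h x1 x2 y1 y2 : x1 <= x2 -> y1 <= y2 ->
      bd_cts g x1 x2 y1 y2 -> bd_cts h x1 x2 y1 y2 ->
      bd_cts (fun z => g z + c * h z) x1 x2 y1 y2 /\
      rectint g x1 x2 y1 y2 + c * rectint h x1 x2 y1 y2 =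
        rectint (fun z => g z + c * h z) x1 x2 y1 y2.
    move=> hx' hy' gc hc; have cc : bd_cts (fun z => c * h z) x1 x2 y1 y2.
      by move=> z zb; apply: ccts_mul; [exact: ccts_cst|exact: hc].
    split; first by move=> z zb; apply: ccts_add; [exact: gc|exact: cc].
    by rewrite rectintD// rectintZ.
  have [c1 E1] := lin (- f a) _ _ _ _ _ _ hx hy kwf kw1.
  have [c2 E2] := lin (- f a) _ _ _ _ _ _ hx hy kaf ka1.
  have [_ E3] := lin (-1) _ _ _ _ _ _ hx hy c1 c2.
  rewrite /cauchy_int E1 E2 E3.
  apply: eq_rectint => // z zb; rewrite /k !expr1.
  have zw := far_ne s20 (sq_far wa zb); have za := far_ne s20 (sq_far a0 zb).
  by field; rewrite !subr_eq0 zw za.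
have kM z : sq_bd a s z -> cabs (k z) <= 8 * M / s ^+ 2 * cabs (w - a).
  move=> zb; have h1 := sq_far wa zb; have h2 := sq_far a0 zb.
  rewrite /k !cabsM cabsV cabsM.
  have h3 : cabs (f z - f a) <= 2 * M.
    apply: le_trans (ler_cabsB _ _) _.
    by have := fM (bd_in zb); have := fM ar; lra.
  have h4 : (cabs (z - w) * cabs (z - a))^-1 <= 4 / s ^+ 2.
    have -> : 4 / s ^+ 2 = (s / 2 * (s / 2))^-1 by field; rewrite gt_eqF.
    have p1 := lt_le_trans s20 h1; have p2 := lt_le_trans s20 h2.
    rewrite lef_pV2 ?posrE; [|exact: mulr_gt0|exact: mulr_gt0].
    by apply: ler_pM => //; exact: ltW.
  have -> : 8 * M / s ^+ 2 * cabs (w - a) = 2 * M * (cabs (w - a) * (4 / s ^+ 2)) by ring.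
  apply: ler_pM => //; rewrite ?cabs_ge0//.
    by rewrite mulr_ge0 ?invr_ge0 ?mulr_ge0 ?cabs_ge0.
  by rewrite ler_wpM2l// cabs_ge0.
have := rectint_bound hx hy kcts kM; rewrite -key cabsM.
have := winding_lower s0 wa; rewrite -/(CI 1 (fun=> 1) w) => N2.
have : cabs (f w - f a) * 2^-1 <= cabs (f w - f a) * cabs (CI 1 (fun=> 1) w).
  by rewrite ler_wpM2l// cabs_ge0.
(* The half-perimeter is 4 * s with s = r / 4, which gives 128 * M / s = 512 * M / r; dividing by
   |N| >= 1/2 doubles this to 1024. *)
have -> : 4 * (8 * M / s ^+ 2 * cabs (w - a)) *
  (complex.Re a + s - (complex.Re a - s) + (complex.Im a + s - (complex.Im a - s))) =
  512 * M / r * cabs (w - a) by rewrite /s; field; rewrite gt_eqF.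
have -> : 1024 * M / r * cabs (w - a) = 2 * (512 * M / r * cabs (w - a)) by ring.
lra.
Qed.

Lemma deriv_bound : cabs (f' a) <= 1024 * M / r.
Proof.
have fa : cdiff f a (f' a) by apply: fd; rewrite subrr cabs0.
have r80 : 0 < r / 8 by rewrite divr_gt0.
by apply: (cdiff_lip fa r80) => w wa; apply: disc_lipschitz; exact: ltW.
Qed.

End Disc.

End CauchyEstimate.

(** * Polydiscs *)

Section SeveralVariables.
Local Open Scope complex_scope.
Context {R : realType} {n : nat}.
Implicit Types (p z w : 'rV[Cx R]_n).
Definition polydisc p (r : R) : set 'rV[Cx R]_n := [set z | forall j, cabs (z 0 j - p 0 j) < r].

Lemma pos_complex (e : R[i]) : 0 < e -> e = (complex.Re e)%:C /\ 0 < complex.Re e.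
Proof.
by case: e => a b; rewrite ltcE /= => /andP[/eqP-> a0]; split.
Qed.

Lemma nbhs_polydisc p (U : set 'rV[Cx R]_n) :
  nbhs p U <-> exists2 r : R, 0 < r & polydisc p r `<=` U.
Proof.
split=> [/nbhs_ballP[e /= e0 eU]|[r r0 rU]].
  have [eE Re0] := pos_complex e0; exists (complex.Re e) => // z zp.
  apply: eU; split=> // i j; rewrite (ord1 i).
  by rewrite -ball_normE /= normr_cabs eE ltcR cabsB.
apply/nbhs_ballP; exists r%:C => /=; first by rewrite ltcR.
move=> z zp; apply: rU => j; have [_ /(_ 0 j)] := zp.
by rewrite -ball_normE /= normr_cabs ltcR cabsB.
Qed.

(** This and [cdiff_derive] pass between directional derivatives and one-variable derivatives along
    the complex line p + t v. *)
Lemma derivable_cdiff (f : 'rV[Cx R]_n -> Cx R) p v (t : R[i]) :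
  derivable f (p + (t : Cx R) *: v) v ->
  cdiff (fun u : R[i] => f (p + (u : Cx R) *: v)) t ('D_v f (p + (t : Cx R) *: v)).
Proof.
move=> /cvg_ex[l fl].
have -> : 'D_v f (p + (t : Cx R) *: v) = l by apply: cvg_lim fl.
move: fl => /cvgrPdist_le fl e e0.
have ec0 : 0 < e%:C by rewrite ltcR.
have /nbhs_ballP[d /= d0 dH] := fl _ ec0.
have [dE Rd0] := pos_complex d0; exists (complex.Re d) => // u ut.
have [->|ut0] := eqVneq u t; first by rewrite !subrr mulr0 subrr cabs0 mulr0.
have ut1 : u - t != 0 by rewrite subr_eq0.
have := dH (u - t); rewrite -ball_normE /= sub0r normrN normr_cabs dE ltcR => /(_ ut ut1).
rewrite addrCA -scalerDl subrK normr_cabs lecR => H.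
have -> : f (p + u *: v) - f (p + t *: v) - l * (u - t) =
    - ((l - (u - t)^-1 *: (f (p + u *: v) - f (p + t *: v))) * (u - t)).
  rewrite -[(u - t)^-1 *: _]/((u - t)^-1 * _) mulrBl mulrAC mulVf// mul1r; ring.
by rewrite cabsN cabsM ler_wpM2r ?cabs_ge0.
Qed.

Lemma cdiff_derive (f : 'rV[Cx R]_n -> Cx R) p v (t l : R[i]) :
  cdiff (fun u : R[i] => f (p + (u : Cx R) *: v)) t l ->
  'D_v f (p + (t : Cx R) *: v) = l.
Proof.
move=> fl; apply: cvg_lim => //; apply/cvgrPdist_le => e e0.
have [eE Re0] := pos_complex e0.
have [d d0 H] := fl _ Re0.
apply/nbhs_ballP; exists d%:C => /=; first by rewrite ltcR.
move=> h; rewrite -ball_normE /= sub0r normrN normr_cabs ltcR => hd h0.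
rewrite eE normr_cabs lecR.
have := H (h + t); rewrite addrK => /(_ hd).
rewrite scalerDl addrCA => {}H.
rewrite -(ler_pM2r (_ : 0 < cabs h)) ?cabs_gt0// -cabsM.
apply: le_trans H; rewrite -cabsN le_eqVlt; apply/orP; left; apply/eqP; congr cabs.
rewrite -[h^-1 *: _]/(h^-1 * _) mulrBl mulrAC mulVf// mul1r; ring.
Qed.

(** Induction on k, applied to the first derivative on half the radius: [deriv_cdiff] keeps it
    differentiable and [deriv_bound] bounds it. The hypotheses concern one line only, the one that
    [pdz j] sees. *)
Lemma pdzk_bound (j : 'I_n) (k : nat) : exists2 C : R, 0 <= C &
  forall (f : 'rV[Cx R]_n -> Cx R) p (r M : R), 0 < r ->
  (forall t : R[i], cabs t < r -> exists l, cdiff (fun u : R[i] => f (p + (u : Cx R) *: evec R j)) t l) ->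
  (forall t : R[i], cabs t < r -> cabs (f (p + (t : Cx R) *: evec R j)) <= M) ->
  cabs (pdzk k j f p) <= C * M / r ^+ k.
Proof.
elim: k => [|k [C C0 IH]].
  exists 1 => // f p r M r0 _ fM; rewrite expr0 divr1 mul1r.
  by have := fM 0; rewrite cabs0 scale0r addr0 => /(_ r0).
(* The bound on the first derivative is 1024 * M / (r / 2) = 2048 * M / r, and (r / 2)^k in the
   denominator contributes 2^k. *)
exists (C * (2048 * 2 ^+ k)); first apply: (mulr_ge0 C0).
  by apply: mulr_ge0; [exact: ler0n|exact/exprn_ge0/ler0n].
move=> f p r M r0 fd fM; rewrite /pdzk iterSr -/(pdzk k j _).
pose g (u : R[i]) : R[i] := f (p + (u : Cx R) *: evec R j).
pose g' (u : R[i]) : R[i] := pdz j f (p + (u : Cx R) *: evec R j).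
have gd t : cabs t < r -> cdiff g t (g' t).
  by move=> tr; have [l fl] := fd _ tr; rewrite /g' /pdz (cdiff_derive fl).
have r20 : 0 < r / 2 by rewrite divr_gt0.
have in2 (t z : R[i]) : cabs t < r / 2 -> cabs (z - t) < r / 2 -> cabs z < r.
  by move=> tr zt; have := ler_cabsD (z - t) t; rewrite subrK; lra.
have := IH (pdz j f) p (r / 2) (1024 * M / (r / 2)) r20.
rewrite -/(pdzk k j _) => {}IH.
rewrite (_ : C * _ * M / _ = C * (1024 * M / (r / 2)) / (r / 2) ^+ k); last first.
  by rewrite expr_div_n exprS; field; rewrite ?expf_neq0 ?gt_eqF.
apply: IH => t tr.
  apply: (@deriv_cdiff _ g g' t (r / 2) M r20) => z zt; have zr := in2 _ _ tr zt.
    exact: gd.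
  exact: fM.
apply: (@deriv_bound _ g g' t (r / 2) M r20) => z zt; have zr := in2 _ _ tr zt.
  exact: gd.
exact: fM.
Qed.

Lemma slice_coord p (j i : 'I_n) (t : R[i]) :
  (p + (t : Cx R) *: evec R j) 0 i = p 0 i + t * (i == j)%:R.
Proof. by rewrite !mxE eqxx. Qed.

Lemma holo_slice (f : 'rV[Cx R]_n -> Cx R) (j : 'I_n) p (t : R[i]) :
  differentiable f (p + (t : Cx R) *: evec R j) ->
  exists l, cdiff (fun u : R[i] => f (p + (u : Cx R) *: evec R j)) t l.
Proof. by move=> /diff_derivable fd; eexists; exact: derivable_cdiff (fd _). Qed.

(* Moving one coordinate at a time reduces to the one-variable estimate. *)
Lemma polydisc_lipschitz (f : 'rV[Cx R]_n -> Cx R) p (r M d : R) w :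
  0 < r -> (forall z, polydisc p r z -> differentiable f z) ->
  (forall z, polydisc p r z -> cabs (f z) <= M) ->
  d <= r / 16 -> (forall j, cabs (w 0 j - p 0 j) <= d) ->
  cabs (f w - f p) <= n%:R * (2048 * M / r * d).
Proof.
move=> r0 fd fM dr wp.
have M0 : 0 <= M.
  have pp : polydisc p r p by move=> j; rewrite subrr cabs0.
  by apply: le_trans (fM _ pp); exact: cabs_ge0.
(* A path from p to w whose i-th point has already taken its first i coordinates from w. *)
pose y (i : nat) : 'rV[Cx R]_n := \row_j (if (j < i)%N then w 0 j else p 0 j).
have y0 : y 0%N = p by apply/rowP => j; rewrite mxE.
have yn : y n = w by apply/rowP => j; rewrite mxE ltn_ord.
have yp i j : cabs (y i 0 j - p 0 j) <= r / 16.
  rewrite mxE; case: ifP => _; first exact: le_trans dr.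
  by rewrite subrr cabs0 divr_ge0// ltW.
suff H i : (i <= n)%N -> cabs (f (y i) - f p) <= i%:R * (2048 * M / r * d).
  by rewrite -[in f w]yn; exact: H.
elim: i => [|i IH] ni; first by rewrite y0 subrr cabs0 mul0r.
apply: le_trans (ler_cabs_dist (f (y i)) _ _) _.
rewrite -natr1 mulrDl mul1r addrC; apply: lerD; first exact/IH/ltnW.
pose j := Ordinal ni.
pose t : R[i] := w 0 j - p 0 j.
have yS : y i.+1 = y i + (t : Cx R) *: evec R j.
  apply/rowP => k; rewrite slice_coord !mxE ltnS leq_eqVlt.
  rewrite -[(k : nat) == i]/(k == j); case: eqVneq => [->|kj] /=.
    by rewrite ltnn mulr1 /t addrC subrK.
  by rewrite mulr0 addr0.
pose g (u : R[i]) : R[i] := f (y i + (u : Cx R) *: evec R j).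
(* A slice disc of radius r / 2 about a path point stays in the polydisc, as r / 16 + r / 2 < r.
   [disc_lipschitz] then reaches increments up to r / 16, whence the condition on d. *)
have r20 : 0 < r / 2 by rewrite divr_gt0.
have inp u : cabs (u - 0) < r / 2 -> polydisc p r (y i + (u : Cx R) *: evec R j).
  rewrite subr0 => ur k; rewrite slice_coord addrAC.
  apply: le_lt_trans (ler_cabsD _ _) _.
  have : cabs (u * (k == j)%:R) <= cabs u.
    by case: (k == j); rewrite ?mulr1 ?mulr0 ?cabs0 ?cabs_ge0.
  have := yp i k; lra.
have gd u : cabs (u - 0) < r / 2 -> exists l, cdiff g u l.
  by move=> /inp /fd /holo_slice.
pose g' u := if pselect (exists l, cdiff g u l) is left e then sval (cid e) else 0.
have g'P u : cabs (u - 0) < r / 2 -> cdiff g u (g' u).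
  by move=> /gd gu; rewrite /g'; case: pselect => // e; exact: svalP (cid e).
have gM u : cabs (u - 0) < r / 2 -> cabs (g u) <= M by move=> /inp /fM.
have := @disc_lipschitz _ g g' 0 (r / 2) M r20 g'P gM t.
rewrite subr0 => H; have := wp j; rewrite -/t => td.
have : cabs (g t - g 0) <= 1024 * M / (r / 2) * cabs t by apply: H; lra.
rewrite /g scale0r addr0 -yS => /le_trans; apply.
rewrite (_ : 1024 * M / (r / 2) = 2048 * M / r); last by field; rewrite gt_eqF.
apply: ler_wpM2l td; apply: divr_ge0; last exact: ltW.
exact: mulr_ge0 (ler0n _ _) M0.
Qed.

End SeveralVariables.

(** * Bounds under the differential inequality *)

Section LocalBound.
Local Open Scope complex_scope.
Context {R : realType} {n : nat}.
Implicit Types (p z w : 'rV[Cx R]_n).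

Lemma cabs_continuous : continuous (fun z : Cx R => cabs z).
Proof.
move=> z A /nbhs_ballP[e /= e0 eA].
apply/nbhs_ballP; exists e%:C => /=; first by rewrite ltcR.
move=> w; rewrite -ball_normE /= normr_cabs ltcR => zw; apply: eA.
rewrite -ball_normE /=; apply: le_lt_trans zw; rewrite ler_norml.
have := ler_cabsD (z - w : R[i]) w; have := ler_cabsD (w - z : R[i]) z.
rewrite !subrK (@cabsB _ w) => h1 h2.
by apply/andP; split; lra.
Qed.

(** The disc is closed and lies in the image of a product of two real segments under (x, y) -> x + i
    y. *)
Lemma closed_disc_compact (c : Cx R) (r : R) :
  compact [set t : Cx R | cabs (t - c : R[i]) <= r].
Proof.
pose h (u : R^o * R^o) : Cx R := (u.1 : R) +i* (u.2 : R).
have hc : continuous h.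
  move=> u; apply/cvgrPdist_lt => e e0; have [eE Re0] := pos_complex e0.
  have e20 : 0 < complex.Re e / 2 by rewrite divr_gt0.
  have /cvgrPdist_lt/(_ _ e20) H1 : v.1 @[v --> u] --> u.1 by exact: cvg_fst.
  have /cvgrPdist_lt/(_ _ e20) H2 : v.2 @[v --> u] --> u.2 by exact: cvg_snd.
  near=> v; rewrite normr_cabs eE ltcR.
  apply: le_lt_trans (cabs_le_ReIm _) _; rewrite ReB ImB /=.
  rewrite [ltRHS]splitr; apply: ltrD; near: v; [exact: H1|exact: H2].
have sq : compact (h @` (`[complex.Re c - r, complex.Re c + r] `*`
                         `[complex.Im c - r, complex.Im c + r])).
  apply: continuous_compact; first by apply: continuous_subspaceT.
  by apply: compact_setX; exact: segment_compact.
apply: subclosed_compact sq _.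
  rewrite (_ : mkset _ = (fun t : Cx R => cabs (t - c : R[i])) @^-1` [set x | x <= r])//.
  apply: preimage_closed; last exact: closed_le.
  move=> t _; apply: (@continuous_comp _ _ _ (fun t : Cx R => t - c) (fun z : Cx R => cabs z)).
    by apply: continuousB; [exact: cvg_id|exact: cst_continuous].
  exact: cabs_continuous.
move=> t /= tr; exists (complex.Re t, complex.Im t); last by case: t {tr}.
have := le_trans (normr_Re_cabs _) tr; have := le_trans (normr_Im_cabs _) tr.
rewrite ReB ImB !ler_norml /= !in_itv /= => /andP[? ?] /andP[? ?].
by split; apply/andP; split; lra.
Unshelve. all: by end_near. Qed.

Lemma closed_polydisc_compact p (r : R) :
  compact [set z : 'rV[Cx R]_n | forall j, cabs (z 0 j - p 0 j : R[i]) <= r].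
Proof.
exact: (@rV_compact (Cx R) n (fun j => [set t : Cx R | cabs (t - p 0 j : R[i]) <= r])
  (fun j => @closed_disc_compact (p 0 j) r)).
Qed.

Lemma unit_vec_le1 (v : 'rV[Cx R]_n) j : unit_vec v -> cabs (v 0 j) <= 1.
Proof.
rewrite /unit_vec => v1; rewrite -(@ler_pXn2r _ 2) ?nnegrE ?cabs_ge0// expr1n -v1.
by rewrite (bigD1 j)//= lerDl sumr_ge0// => i _; rewrite sqr_ge0.
Qed.

Lemma powR_le_root (x y a : R) : 0 <= x -> 0 <= y -> 0 < a -> x `^ a <= y -> x <= y `^ a^-1.
Proof.
move=> x0 y0 a0 xy.
rewrite -[leLHS](powRr1 x0) -(mulfV (lt0r_neq0 a0)) powRrM.
by rewrite ge0_ler_powR// ?nnegrE ?invr_ge0 ?powR_ge0// ltW.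
Qed.

(** The sup-norm distance as an element of R; the norm of the row space takes its values in R[i]. *)
Definition pdist p z : R := \big[Num.max/0]_(j < n) cabs (z 0 j - p 0 j).

Lemma pdistP p z (x : R) : 0 <= x ->
  (pdist p z <= x) = [forall j, cabs (z 0 j - p 0 j) <= x].
Proof.
move=> x0; apply/bigmax_leP/forallP => [[_ H] j|H]; first exact: H.
by split=> // j _; exact: H.
Qed.

Lemma pdist_ge0 p z : 0 <= pdist p z.
Proof. exact: bigmax_ge_id. Qed.

Lemma cabs_le_pdist p z j : cabs (z 0 j - p 0 j) <= pdist p z.
Proof. exact: le_bigmax. Qed.

End LocalBound.

Section GrowthBound.
Local Open Scope complex_scope.
Context {R : realType} {n : nat}.
Implicit Types (p z w : 'rV[Cx R]_n).

Lemma cabs_sum m (F : 'I_m -> R[i]) : cabs (\sum_j F j) <= \sum_j cabs (F j).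
Proof.
elim/big_rec2: _ => [|j x y _ H]; first by rewrite cabs0.
by apply: le_trans (ler_cabsD _ _) _; rewrite lerD2l.
Qed.

Lemma Dk_pair_bound (k : nat) : exists2 C : R, 0 < C &
  forall (f : 'rV[Cx R]_n -> Cx R) p v (r M : R), 0 < r -> unit_vec v ->
  (forall z, polydisc p r z -> differentiable f z) ->
  (forall z, polydisc p r z -> cabs (f z) <= M) ->
  cabs (Dk_pair k f p v) <= C * M / r ^+ k.
Proof.
have /choice[C HC] : forall j : 'I_n, exists C : R, 0 <= C /\
  forall (f : 'rV[Cx R]_n -> Cx R) p (r M : R), 0 < r ->
  (forall t : R[i], cabs t < r ->
    exists l, cdiff (fun u : R[i] => f (p + (u : Cx R) *: evec R j)) t l) ->
  (forall t : R[i], cabs t < r -> cabs (f (p + (t : Cx R) *: evec R j)) <= M) ->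
  cabs (pdzk k j f p) <= C * M / r ^+ k.
  by move=> j; have [C C0 H] := @pdzk_bound R n j k; exists C.
have S0 : 0 <= \sum_j C j by rewrite sumr_ge0// => j _; case: (HC j).
exists (1 + \sum_j C j); first by rewrite ltr_pwDl.
move=> f p v r M r0 v1 fd fM.
have pp : polydisc p r p by move=> j; rewrite subrr cabs0.
have M0 : 0 <= M by apply: le_trans (fM _ pp); exact: cabs_ge0.
have inp j (t : R[i]) : cabs t < r -> polydisc p r (p + (t : Cx R) *: evec R j).
  move=> tr i; rewrite slice_coord addrAC subrr add0r cabsM.
  apply: le_lt_trans tr; case: (i == j); rewrite ?cabs1 ?cabs0 ?mulr1 ?mulr0//.
  exact: cabs_ge0.
have r0k : 0 <= (r ^+ k)^-1 by rewrite invr_ge0 exprn_ge0// ltW.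
have H j : cabs (pdzk k j f p) <= C j * M / r ^+ k.
  have [_ {}HC] := HC j; apply: HC => // t tr.
    by apply: holo_slice; apply: fd; exact: inp.
  by apply: fM; exact: inp.
apply: le_trans (cabs_sum _) _.
apply: (@le_trans _ _ (\sum_j C j * M / r ^+ k)).
  apply: ler_sum => j _; rewrite cabsM; apply: le_trans (H j).
  by rewrite ler_piMr ?cabs_ge0// unit_vec_le1.
rewrite -!mulr_suml; apply: ler_wpM2r => //; apply: ler_wpM2r => //.
by rewrite lerDr.
Qed.

(** M is chosen before f and p: this uniformity over the family is what Montel's theorem needs. *)
Lemma growth_bound (k : nat) (c alpha r : R) : 0 < c -> 1 < alpha -> 0 < r ->
  exists M : R, forall (f : 'rV[Cx R]_n -> Cx R) p,
  (forall z, (forall j, cabs (z 0 j - p 0 j) <= r) -> differentiable f z) ->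
  (forall z, (forall j, cabs (z 0 j - p 0 j) <= r) -> exists v, unit_vec v /\
     c * (1 + powR (cabs (f z)) alpha) < cabs (Dk_pair k f z v)) ->
  forall z, polydisc p (r / 2) z -> cabs (f z) <= M.
Proof.
move=> c0 a1 r0; have [C C0 HC] := Dk_pair_bound k.
pose a := alpha - 1; have a0 : 0 < a by rewrite subr_gt0.
(* B compares |f| near a near-maximum with its value there: 2^(k+1) for halving the distance to the
   boundary, one more 2 for the near-maximum. T will bound d^k |f|^a there, and S bounds |f|^a
   wherever the weight is at least (r / 2)^(k+1). *)
pose B := (2 ^+ k.+2 : R) `^ a^-1.
pose T := C * B * 2 ^+ k / c.
pose S := 2 * r * T / (r / 2) ^+ k.+1.
exists (S `^ a^-1) => f p fd fgrow.
pose K := [set z : 'rV[Cx R]_n | forall j, cabs (z 0 j - p 0 j : R[i]) <= r].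
have Kp : K p by move=> j; rewrite subrr cabs0 ltW.
(* F depends on f; it only ensures that the supremum of [phi] is finite. *)
have [F HF] : exists F, forall z, K z -> cabs (f z) <= F.
  have cK := @closed_polydisc_compact R n p r.
  have cf : {within K, continuous (fun z => cabs (f z))}.
    apply: continuous_in_subspaceT => z /set_mem Kz.
    apply: (@continuous_comp _ _ _ f (fun z : Cx R => cabs z)); last exact: cabs_continuous.
    by apply: differentiable_continuous; exact: fd.
  have [|z zK Hz] := compact_EVT_max _ cK cf; first by exists p.
  by exists (cabs (f z)) => w Kw; apply: Hz; exact/mem_set.
have Kdist z : K z <-> pdist p z <= r.
  by rewrite pdistP ?(ltW r0)//; split=> [?|/forallP//]; apply/forallP.
pose phi z := (r - pdist p z) ^+ k.+1 * cabs (f z) `^ a.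
have phi_ge0 z : K z -> 0 <= phi z.
  by move=> /Kdist zr; rewrite mulr_ge0 ?powR_ge0// exprn_ge0// subr_ge0.
have hs : has_sup (phi @` K).
  split; first by exists (phi p), p.
  exists (r ^+ k.+1 * F `^ a) => _ [z Kz <-]; have zr := (Kdist z).1 Kz.
  apply: ler_pM; rewrite ?powR_ge0 ?exprn_ge0 ?subr_ge0//.
    by apply: lerXn2r; rewrite ?nnegrE ?subr_ge0 ?(ltW r0)// gerBl pdist_ge0.
  apply: ge0_ler_powR; rewrite ?nnegrE ?cabs_ge0 ?(ltW a0)//; last exact: HF.
  by apply: le_trans (HF _ Kp); exact: cabs_ge0.
have B0 : 0 <= B by exact: powR_ge0.
have T0 : 0 <= T.
  by rewrite /T divr_ge0 ?(ltW c0)// !mulr_ge0 ?exprn_ge0// ltW.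
have rT0 : 0 <= 2 * r * T.
  by apply: mulr_ge0 => //; apply: mulr_ge0; [exact: ler0n|exact: ltW].
have supT : sup (phi @` K) <= 2 * r * T.
  (* If L > 2 * r * T, a point with phi z > L / 2 exists; the estimates there give phi z <= r * T, a
     contradiction. *)
  rewrite leNgt; apply/negP => Ls; set L := sup _ in Ls.
  have L0 : 0 < L by exact: le_lt_trans Ls.
  have L20 : 0 < L / 2 by rewrite divr_gt0.
  have [_ [z Kz <-]] := sup_adherent L20 hs; rewrite -/L => zL.
  have {}zL : L < 2 * phi z by lra.
  have zr := (Kdist z).1 Kz.
  pose d := r - pdist p z; pose A := cabs (f z).
  have A0 : 0 <= A by exact: cabs_ge0.
  have phi0 : 0 < phi z by lra.
  have d0 : 0 < d.
    rewrite lt_neqAle eq_sym subr_ge0 zr andbT; apply/eqP => d0.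
    by move: phi0; rewrite /phi -/d d0 expr0n mul0r ltxx.
  have A1 : 0 < A.
    rewrite lt_neqAle eq_sym A0 andbT; apply/eqP => A0'.
    by move: phi0; rewrite /phi -/A A0' powR0 ?gt_eqF// mulr0 ltxx.
  have d20 : 0 < d / 2 by rewrite divr_gt0.
  have dr : d <= r by rewrite gerBl pdist_ge0.
  have near w : polydisc z (d / 2) w -> K w /\ d / 2 <= r - pdist p w.
    move=> wz; suff wd : pdist p w <= r - d / 2.
      by split; [apply/Kdist; lra|lra].
    rewrite pdistP; last lra.
    apply/forallP => j; apply: le_trans (ler_cabs_dist (z 0 j) _ _) _.
    have := cabs_le_pdist p z j; have := wz j; rewrite /d; lra.
  have fB w : polydisc z (d / 2) w -> cabs (f w) <= B * A.
    move=> /near[Kw wd].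
    have wL : phi w <= L by apply: sup_upper_bound => //; exists w.
    have -> : B * A = (2 ^+ k.+2 * A `^ a) `^ a^-1.
      rewrite powRM ?exprn_ge0 ?powR_ge0// -/B -powRrM mulfV ?gt_eqF//.
      by rewrite powRr1.
    apply: powR_le_root => //; first exact: cabs_ge0.
      by rewrite mulr_ge0 ?exprn_ge0 ?powR_ge0.
    have dk0 : 0 < (d / 2) ^+ k.+1 by rewrite exprn_gt0.
    rewrite -(ler_pM2l dk0).
    apply: (@le_trans _ _ (phi w)).
      apply: ler_wpM2r; first exact: powR_ge0.
      by apply: lerXn2r; rewrite ?nnegrE ?(ltW d20)// (le_trans _ wd)// ltW.
    apply: (le_trans wL); apply: (le_trans (ltW zL)).
    rewrite /phi -/d -/A le_eqVlt; apply/orP; left; apply/eqP.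
    by rewrite expr_div_n [2 ^+ k.+2]exprS; field; rewrite expf_neq0.
  have [v [v1 grow]] := fgrow z Kz.
  have := HC f z v (d / 2) (B * A) d20 v1.
  have fdz w : polydisc z (d / 2) w -> differentiable f w by move=> /near[/fd].
  move=> /(_ fdz fB) HD.
  have : c * A `^ alpha < C * (B * A) / (d / 2) ^+ k.
    apply: lt_le_trans HD; apply: le_lt_trans grow.
    by rewrite ler_pM2l// lerDr.
  (* Splitting |f|^alpha as |f| * |f|^a allows the common factor A > 0 to be cancelled. *)
  rewrite -mulr_powRB1 ?(lt_trans _ a1)// -/a.
  rewrite (_ : C * _ / _ = A * (C * B * 2 ^+ k / d ^+ k)); last first.
    by rewrite expr_div_n; field; rewrite !expf_neq0// gt_eqF.
  rewrite mulrCA ltr_pM2l// ltr_pdivlMr ?exprn_gt0// => lt1.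
  have : d ^+ k * A `^ a < T by rewrite /T ltr_pdivlMr// mulrC; lra.
  move=> lt2.
  have : phi z <= r * T.
    rewrite /phi -/d -/A exprS -mulrA; apply: ler_pM => //; first exact: ltW.
      by rewrite mulr_ge0 ?powR_ge0// exprn_ge0// ltW.
    exact: ltW.
  lra.
move=> z zp.
have zr2 : pdist p z <= r / 2.
  by rewrite pdistP ?divr_ge0 ?(ltW r0)//; apply/forallP => j; exact: ltW.
have Kz : K z by apply/Kdist; lra.
have phiz : phi z <= 2 * r * T.
  by apply: le_trans supT; apply: sup_upper_bound => //; exists z.
have rk0 : 0 < (r / 2) ^+ k.+1 by rewrite exprn_gt0// divr_gt0.
apply: powR_le_root => //; first exact: cabs_ge0.
  by apply: divr_ge0 => //; exact: ltW.
rewrite /S ler_pdivlMr// mulrC; apply: le_trans phiz.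
apply: ler_wpM2r; first exact: powR_ge0.
by apply: lerXn2r; rewrite ?nnegrE ?divr_ge0 ?subr_ge0 ?(ltW r0)//; lra.
Qed.

End GrowthBound.

(** * Montel's theorem *)

Section Montel.
Local Open Scope complex_scope.
Context {R : realType} {n : nat}.
Implicit Types (p z w : 'rV[Cx R]_n) (D : set 'rV[Cx R]_n).

Lemma polydisc_center p (r : R) : 0 < r -> polydisc p r p.
Proof. by move=> r0 j; rewrite subrr cabs0. Qed.

Lemma pdist_lt p z (r : R) : 0 < r -> polydisc p r z -> pdist p z < r.
Proof. by move=> r0 zp; apply: bigmax_lt => // j _; exact: zp. Qed.

Lemma polydisc_trans p z w (r s : R) :
  polydisc p r z -> polydisc z s w -> polydisc p (r + s) w.
Proof.
move=> pz zw j; apply: le_lt_trans (ler_cabs_dist (z 0 j) _ _) _.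
by rewrite addrC ltrD.
Qed.

(** The usual compact exhaustion. Asking for a polydisc inside D replaces the distance to the
    complement, so D = C^n is not a special case. *)
Definition exhaustion D (j : nat) : set 'rV[Cx R]_n :=
  [set z : 'rV[Cx R]_n | (forall i, cabs (z 0 i : R[i]) <= j%:R) /\ polydisc z (j.+1%:R^-1) `<=` D].

Lemma exhaustion_compact D j : compact (exhaustion D j).
Proof.
refine (subclosed_compact _ (@closed_polydisc_compact R n 0 j%:R) _); last first.
  by move=> z [H _] i; rewrite mxE subr0.
have j0 : 0 < j.+1%:R^-1 :> R by rewrite invr_gt0 ltr0n.
move=> z cz; split=> [i|w zw].
  apply/ler_addgt0Pr => e e0.
  have zU : nbhs z (polydisc z e) by apply/nbhs_polydisc; exists e.
  have [z' [[z'j _] zz']] := cz _ zU.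
  have := ler_cabsD (z 0 i - z' 0 i) (z' 0 i); rewrite subrK cabsB => /le_trans; apply.
  by rewrite addrC lerD// ltW.
(* A member z' of the set within this slack of z still has w in its polydisc of radius 1 / (j +
   1). *)
have e0 : 0 < j.+1%:R^-1 - pdist z w by rewrite subr_gt0 pdist_lt.
have zU : nbhs z (polydisc z (j.+1%:R^-1 - pdist z w)).
  by apply/nbhs_polydisc; exists (j.+1%:R^-1 - pdist z w).
have [z' [[_ z'D] zz']] := cz _ zU; apply: z'D => i.
apply: le_lt_trans (ler_cabs_dist (z 0 i) _ _) _.
rewrite (cabsB (z 0 i)).
have := cabs_le_pdist z w i; have := zz' i.
by move=> h1 h2; have := ler_ltD h2 h1; rewrite [ltRHS]addrC subrK.
Qed.

Lemma exhaustion_sub D j : exhaustion D j `<=` D.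
Proof. by move=> z [_]; apply; apply: polydisc_center; rewrite invr_gt0 ltr0n. Qed.

Lemma exhaustion_mono D i j : (i <= j)%N -> exhaustion D i `<=` exhaustion D j.
Proof.
move=> ij z [zi zD]; split=> [l|w zw]; first by apply: le_trans (zi l) _; rewrite ler_nat.
by apply: zD => l; apply: lt_le_trans (zw l) _; rewrite lef_pV2 ?posrE ?ltr0n// ler_nat.
Qed.

Lemma exhaustion_nbhs D z : open D -> D z ->
  exists j, exists2 U, nbhs z U & U `<=` exhaustion D j.
Proof.
move=> oD Dz; have /nbhs_polydisc[r r0 rD] := open_nbhs_nbhs (conj oD Dz).
have r20 : 0 < r / 2 by rewrite divr_gt0.
(* For j > x, the term 2 / r gives 1 / (j + 1) <= r / 2, and the other two bound the coordinates of
   points in the polydisc of radius r / 2 about z. *)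
pose x := 2 / r + pdist 0 z + r / 2.
have x0 : 0 <= x by rewrite !addr_ge0 ?pdist_ge0 ?divr_ge0// ltW.
have p0 := pdist_ge0 0 z.
exists (Num.bound x); exists (polydisc z (r / 2)).
  by apply/nbhs_polydisc; exists (r / 2).
have jx := archi_boundP x0; set j := Num.bound x in jx *.
move=> w zw; split=> [i|v wv].
  apply: (@le_trans _ _ (cabs (w 0 i - z 0 i) + cabs (z 0 i))).
    by have := ler_cabsD (w 0 i - z 0 i) (z 0 i); rewrite subrK.
  have := zw i; have := cabs_le_pdist 0 z i; rewrite mxE subr0.
  have : 0 <= 2 / r by rewrite divr_ge0// ltW.
  rewrite /x in jx; lra.
apply: rD => i; rewrite (splitr r); apply: (polydisc_trans zw) => l.
apply: lt_le_trans (wv l) _.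
rewrite -[r / 2]invrK lef_pV2 ?posrE ?invr_gt0// ?ltr0n//.
rewrite invf_div -natr1; rewrite /x in jx; lra.
Qed.

Definition locally_bounded D (u : nat -> 'rV[Cx R]_n -> Cx R) :=
  forall z, D z -> exists r : R, exists M : R,
    [/\ 0 < r, polydisc z r `<=` D &
        forall m w, polydisc z r w -> cabs (u m w) <= M].

(** The constant in [polydisc_lipschitz] depends only on the radius and the local bound, hence is
    common to all u m. *)
Lemma equicontinuous D u z (e : R) : (forall m w, D w -> differentiable (u m) w) ->
  locally_bounded D u -> D z -> 0 < e -> exists2 d : R, 0 < d &
  polydisc z d `<=` D /\ forall m w, polydisc z d w -> cabs (u m w - u m z) <= e.
Proof.
move=> ud ub Dz e0; have [r [M [r0 rD rM]]] := ub _ Dz.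
pose L := 1 + `|n%:R * (2048 * M / r)|.
have L0 : 0 < L by rewrite ltr_pwDl.
pose d := Num.min (r / 16) (e / L).
have d0 : 0 < d by rewrite lt_min !divr_gt0.
have dr : d <= r / 16 by rewrite ge_min lexx.
have de : d * L <= e by rewrite -ler_pdivlMr// ge_min lexx orbT.
exists d => //; split=> [w zw|m w zw].
  by apply: rD => i; apply: lt_le_trans (zw i) _; apply: le_trans dr _; lra.
have udz w' : polydisc z r w' -> differentiable (u m) w' by move=> /rD /ud.
apply: le_trans (polydisc_lipschitz r0 udz (rM m) dr _) _.
  by move=> i; exact: ltW.
rewrite mulrA; apply: le_trans de; rewrite mulrC; apply: ler_wpM2l; first exact: ltW.
by apply: le_trans (ler_norm _) _; rewrite lerDr.
Qed.

(** Compactness of the disc gives a cluster point, and an ultrafilter converges to each of its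
    cluster points. *)
Lemma ultrafilter_limit (G : set_system nat) (v : nat -> R[i]) (M : R) :
  UltraFilter G -> (forall m, cabs (v m) <= M) ->
  exists l : R[i], forall e : R, 0 < e -> G [set m | cabs (v m - l) < e].
Proof.
move=> GU vM.
pose V : nat -> Cx R := v.
have GP : ProperFilter G by exact: ultra_proper.
have GV : G (V @^-1` [set t : Cx R | cabs (t - 0 : R[i]) <= M]).
  by apply: filterS filterT => m _ /=; rewrite /V subr0; exact: vM.
have [l [_ Vl]] := @closed_disc_compact R 0 M (V @ G) _ GV.
exists l => e e0; have ec0 : 0 < e%:C by rewrite ltcR.
have [//|GC] := in_ultra_setVsetC [set m | cabs (v m - l) < e] GU.
have lB : nbhs (l : Cx R) (ball (l : Cx R) e%:C) by exact: nbhsx_ballx.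
have GC' : G (V @^-1` [set t : Cx R | ~ cabs (t - l : R[i]) < e]) by exact: GC.
have [t [/= nt]] := Vl _ _ GC' lB.
by rewrite -ball_normE /= normr_cabs ltcR cabsB.
Qed.

(* The limit is taken pointwise along an ultrafilter G refining the Frechet
   filter; equicontinuity makes the convergence along G uniform on compact
   sets, and a subsequence is then read off from G-large sets, without a
   diagonal argument. *)
Lemma montel D u : open D -> (forall m w, D w -> differentiable (u m) w) ->
  locally_bounded D u ->
  exists phi : nat -> nat, {homo phi : a b / (a < b)%N} /\
  exists g : 'rV[Cx R]_n -> Cx R,
    forall z, D z -> exists U, nbhs z U /\
      forall eps : R, 0 < eps -> exists N : nat, forall m, (N <= m)%N ->
        forall w, U w -> D w -> cabs (u (phi m) w - g w) < eps.
Proof.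
move=> oD ud ub.
have [G [GU oG]] := ultraFilterLemma (F := \oo) _.
have GP : ProperFilter G by exact: ultra_proper.
have /choice[g gP] : forall z, exists l : R[i], D z ->
    forall e : R, 0 < e -> G [set m | cabs (u m z - l) < e].
  move=> z; have [Dz|nDz] := pselect (D z); last by exists 0.
  have [r [M [r0 _ rM]]] := ub _ Dz.
  have [m|l lP] := @ultrafilter_limit G (fun m => u m z) M GU; last by exists l.
  exact: rM (polydisc_center _ r0).
have gD z : D z -> forall e : R, 0 < e -> exists2 d : R, 0 < d &
    G [set m | forall w, polydisc z d w -> cabs (u m w - g w) < e].
  move=> Dz e e0; have e80 : 0 < e / 8 by rewrite divr_gt0.
  have [d d0 [dD dH]] := equicontinuous ud ub Dz e80.
  exists d => //; apply: filterS (gP z Dz _ e80) => m /= mz w zw.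
  (* The index m is controlled at z only. The auxiliary m', which may depend on w, is close to g at
     both z and w and carries the estimate from z to w; five terms of at most e / 8 result. *)
  have [m' [/= h1 h2]] : exists m', [set m | cabs (u m z - g z) < e / 8] m' /\
      [set m | cabs (u m w - g w) < e / 8] m'.
    apply: (@filter_ex _ G); apply: filterI; apply: gP => //; exact: dD.
  have h3 := dH m w zw; have h4 := dH m' w zw.
  have -> : u m w - g w = (u m w - u m z) + (u m z - g z) + (g z - u m' z)
    + (u m' z - u m' w) + (u m' w - g w) by ring.
  apply: le_lt_trans (ler_cabsD _ _) _.
  apply: le_lt_trans (lerD (ler_cabsD _ _) (lexx _)) _.
  apply: le_lt_trans (lerD (lerD (ler_cabsD _ _) (lexx _)) (lexx _)) _.
  apply: le_lt_trans (lerD (lerD (lerD (ler_cabsD _ _) (lexx _)) (lexx _)) (lexx _)) _.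
  rewrite (cabsB (g z)) (cabsB (u m' z) (u m' w)); lra.
pose S j := [set m | forall z, exhaustion D j z -> cabs (u m z - g z) < j.+1%:R^-1].
(* Compactness in its near-covering form turns the local uniformity of [gD] into uniformity on the
   whole compact set. *)
have GS j : G (S j).
  have /compact_near_coveringP := @exhaustion_compact D j.
  move=> /(_ nat G (fun m z => cabs (u m z - g z) < j.+1%:R^-1)); apply.
  move=> z zj; have Dz := exhaustion_sub zj.
  have j0 : 0 < j.+1%:R^-1 :> R by rewrite invr_gt0 ltr0n.
  have [d d0 H] := gD z Dz _ j0.
  exists (polydisc z d, [set m | forall w, polydisc z d w -> cabs (u m w - g w) < j.+1%:R^-1]).
    by split => //=; apply/nbhs_polydisc; exists d.
  by move=> [w m] /= [zw mS]; exact: mS.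
(* G contains all cofinal tails, so each G-large set has members beyond any N; choosing beyond the
   previous index makes phi strictly increasing. *)
have /choice[pick pickP] : forall jN : nat * nat, exists m, (jN.2 < m)%N /\ S jN.1 m.
  move=> [j N] /=; apply: (@filter_ex _ G).
  apply: filterI (GS j); apply: oG; exact: nbhs_infty_gt.
pose phi := fix phi j := if j is i.+1 then pick (i.+1, phi i) else pick (0%N, 0%N).
have phiS j : S j (phi j).
  by case: j => [|j]; [have [] := pickP (0%N, 0%N)|have [] := pickP (j.+1, phi j)].
exists phi; split.
  apply: homo_ltn => [y x z|j]; first exact: ltn_trans.
  by have [] := pickP (j.+1, phi j).
exists g => z Dz; have [J [U zU UJ]] := exhaustion_nbhs oD Dz.
exists U; split=> // e e0; pose N := Num.bound e^-1.
(* From J on, the m-th compact set contains U; from N on, 1 / (m + 1) <= e. *)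
exists (maxn J N) => m; rewrite geq_max => /andP[Jm Nm] w Uw _.
apply: lt_le_trans (phiS m w _) _; first exact: exhaustion_mono (UJ _ Uw).
rewrite -[e]invrK lef_pV2 ?posrE ?invr_gt0 ?ltr0n//.
apply: le_trans (ltW (archi_boundP _)) _; first by rewrite invr_ge0 ltW.
by rewrite ler_nat ltnW.
Qed.

End Montel.

(** A supremum exceeds c exactly when the quotient does so for some v, and the denominator is
    positive; hence the existential form with the denominator multiplied out. *)
Theorem theorem10 (R : realType) (n : nat) (D : set 'rV[Cx R]_n) (k : nat)
  (c alpha : R) :
  domain D -> 0 < c -> 1 < alpha ->
  normal_family D
    [set f | holomorphic_on D f /\
       forall z, D z -> exists v : 'rV[Cx R]_n, unit_vec v /\
         c * (1 + powR (cabs (f z)) alpha) < cabs (Dk_pair k f z v)].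
Proof.
move=> [_ [oD _]] c0 a1 u uF; apply: montel => //.
  by move=> m w Dw; have [/(_ w Dw)] := uF m.
move=> z Dz; have /nbhs_polydisc[r r0 rD] := open_nbhs_nbhs (conj oD Dz).
have r20 : 0 < r / 2 by rewrite divr_gt0.
(* The radius r / 2 places the closed polydisc inside the open one of radius r contained in D. *)
have [M HM] := @growth_bound R n k _ _ _ c0 a1 r20.
have inD (w : 'rV[Cx R]_n) : (forall j, cabs (w 0 j - z 0 j) <= r / 2) -> D w.
  by move=> H; apply: rD => j; apply: le_lt_trans (H j) _; lra.
exists (r / 2 / 2), M; split; first by rewrite divr_gt0.
  by move=> w zw; apply: inD => j; apply: le_trans (ltW (zw j)) _; lra.
move=> m w zw; have [hol grow] := uF m.
by apply: HM zw => w' /inD; [exact: hol|exact: grow].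
Qed.
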